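(* On the domain with coordinates $(s,t,\theta,\phi,\tau,\chi)$, $s<-3$, $-\tfrac32<t<0$, $0<\theta<\pi$, and $\phi,\tau,\chi$ angular coordinates, consider the Riemannian metric $$ds^2=\frac14 st\left(d\theta^2+\sin^2\theta\,d\phi^2\right)+\frac{t-s}{4Q(s)}ds^2+\frac{3(s-t)}{4t(2t+3)}dt^2+\frac{Q(s)}{t-s}\left[\left(\tfrac t3+1\right)d\chi-\tfrac t2\,\eta\right]^2+\frac{t(2t+3)}{3(s-t)}\left[\left(\tfrac s3+1\right)d\chi-\tfrac s2\,\eta\right]^2,$$ where $Q(s)=\frac{2s^2}{3}+s+\frac9s$ and $\eta=d\tau+(1-\cos\theta)d\phi$. (1) This metric is Kähler and Ricci-flat. (2) Its restriction to the exceptional divisor (obtained by letting $s\to-3$ and setting $ds=0$, $d\chi=0$) is the metric $$ds^2_{\mathcal{ED}}=-\frac{3t}{4}\left(d\theta^2+\sin^2\theta\,d\phi^2\right)-\frac{3(t+3)}{4t(2t+3)}dt^2-\frac{3t(2t+3)}{4(t+3)}\,\eta^2,$$ and this coincides with the Kähler metric $\sum g_{ij^\star}\,dz^i\,d\bar z^{j^\star}$, $g_{ij^\star}=\partial_i\partial_{j^\star}\mathcal{K}$, $z=(u,v)$, induced on $\mathbb{WP}[112]$ by the Kronheimer construction, whose Kähler potential is $$\mathcal{K}(\varpi)=\frac94\left[\frac{3\varpi+\sqrt{\varpi(\varpi+8)}}{\varpi+\sqrt{\varpi(\varpi+8)}}+\log\left(\varpi+\sqrt{\varpi(\varpi+8)}+4\right)\right]+\text{const},\qquad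 \varpi=(1+|u|^2)^2|v|^2,$$ under the identification $u=\tan\frac\theta2\,e^{i\phi}$, $\arg v=\tau$, $t=-\frac23\varpi\,\partial_\varpi\mathcal{K}(\varpi)$ (equivalently $\varpi=\frac{8t^2}{3(2t+3)}$).
   Context: The metric in (1) is the ''orthotoric'' metric, associated with the total space of the canonical bundle of the weighted projective space $\mathbb{WP}[112]$, a partial resolution of $\mathbb{C}^3/\mathbb{Z}_4$; the exceptional divisor $\mathbb{WP}[112]$ is the locus $s=-3$. The Kähler form is $$\mathbb{K}=E^1\wedge E^2+E^3\wedge E^5+E^4\wedge E^6,$$ where, with $\Upsilon(s)^2=\frac{-s}{\frac23s^2-s+3}$ and $P(t)^2=\frac{1}{-\frac23t^2-t}$ (positive roots), $$E^1=\tfrac12\sqrt{st}\,d\theta,\quad E^2=\tfrac12\sqrt{st}\sin\theta\,d\phi,\quad E^3=\tfrac12\sqrt{\tfrac{s-t}{3+s}}\,\Upsilon\,ds,\quad E^4=\tfrac12\sqrt{t-s}\,P\,dt,$$ $$E^5=-\tfrac{1}{\sqrt{\frac{s-t}{3+s}}\,\Upsilon}\left[\left(\tfrac t3+1\right)d\chi-\tfrac t2\eta\right],\quad E^6=-\tfrac{1}{\sqrt{t-s}\,P}\left[\left(\tfrac s3+1\right)d\chi-\tfrac s2\eta\right],$$ so that the metric equals $\sum_{i=1}^6(E^i)^2$. In the paper the periodicities of $\phi,\tau,\chi$ are $2\pi,2\pi,\tfrac{3}{2}\pi$. On the divisor, $u,v$ are complex coordinates of a dense open chart. The potential $\mathcal{K}$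 is, up to the overall factor $9/8$ used by the paper as a normalization of the metric, the Kähler potential obtained from the Kronheimer construction restricted to the exceptional divisor with Fayet–Iliopoulos parameters on the type III wall ($\alpha=0$). *)

(* Defs.v *)
(* Stdlib reals with Coquelicot. *)
From Stdlib Require Export Reals List.
From Coquelicot Require Export Coquelicot.
Import ListNotations.
Open Scope R_scope.

(** * Tensor calculus in coordinates

   A point of R^I, I a finite set of coordinate labels, is a function I -> R;
   Coquelicot's uniform structure on I -> R is that of the sup norm. *)

Class FinIndex (I : Type) := {
  index_eq_dec : forall i j : I, {i = j} + {i <> j};
  index_enum : list I;
  index_enum_nodup : NoDup index_enum;
  index_enum_full : forall i, In i index_enum
}.

Section Calculus.

Context {I : Type} {FI : FinIndex I}.

Definition rsum (F : I -> R) : R :=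
  fold_right (fun i acc => F i + acc) 0 index_enum.

Definition csum (F : I -> C) : C :=
  fold_right (fun i acc => Cplus (F i) acc) (RtoC 0) index_enum.

Definition update {V : Type} (x : I -> V) (i : I) (a : V) : I -> V :=
  fun j => if index_eq_dec i j then a else x j.

Definition partial (i : I) (f : (I -> R) -> R) : (I -> R) -> R :=
  fun x => Derive (fun a => f (update x i a)) (x i).

Fixpoint partials (l : list I) (f : (I -> R) -> R) : (I -> R) -> R :=
  match l with
  | nil => f
  | i :: l' => partial i (partials l' f)
  end.

(* Class C^oo on U (meant for open U). *)
Definition smooth_on (U : (I -> R) -> Prop) (f : (I -> R) -> R) : Prop :=
  forall (l : list I) (x : I -> R), U x ->
    continuous (T := fct_UniformSpace I R_UniformSpace) (U := R_UniformSpace)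
      (partials l f) x /\
    forall i, ex_derive (fun a => partials l f (update x i a)) (x i).

(* The coordinate covector d x^i, as the vector of its components. *)
Definition dcoord (i : I) : I -> R :=
  fun j => if index_eq_dec i j then 1 else 0.

(* alpha (x) alpha, the square of a one-form in a line element. *)
Definition sq (alpha : I -> R) : I -> I -> R := fun i j => alpha i * alpha j.

(* (alpha /\ beta)(X, Y) = alpha(X) beta(Y) - alpha(Y) beta(X). *)
Definition wedge (alpha beta : I -> R) : I -> I -> R :=
  fun i j => alpha i * beta j - alpha j * beta i.

(* Fields of 2-tensors, with T x i j = T_x(d/dx^i, d/dx^j). *)
Definition field2 : Type := (I -> R) -> I -> I -> R.

Definition smooth2_on (U : (I -> R) -> Prop) (T : field2) : Prop :=
  forall i j, smooth_on U (fun x => T x i j).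

Definition riemannian (U : (I -> R) -> Prop) (g : field2) : Prop :=
  smooth2_on U g /\
  (forall x, U x -> forall i j, g x i j = g x j i) /\
  (forall x, U x -> forall X : I -> R, (exists i, X i <> 0) ->
     0 < rsum (fun i => rsum (fun j => g x i j * X i * X j))).

(* Components Gamma x k i j = Gamma^k_{ij} of an affine connection. *)
Definition connection : Type := (I -> R) -> I -> I -> I -> R.

(* Torsion-free and metric; on an open U these conditions determine Gamma
   when g is a Riemannian metric. *)
Definition levi_civita (U : (I -> R) -> Prop) (g : field2)
    (Gamma : connection) : Prop :=
  forall x, U x ->
    (forall k i j, Gamma x k i j = Gamma x k j i) /\
    (forall k i j, partial k (fun y => g y i j) x =
       rsum (fun l => Gamma x l k i * g x l j + Gamma x l k j * g x i l)).

(* R_{jk} = d_i Gamma^i_{jk} - d_j Gamma^i_{ik}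
            + Gamma^i_{il} Gamma^l_{jk} - Gamma^i_{jl} Gamma^l_{ik}. *)
Definition ricci (Gamma : connection) : field2 := fun x j k =>
  rsum (fun i => partial i (fun y => Gamma y i j k) x
                 - partial j (fun y => Gamma y i i k) x)
  + rsum (fun i => rsum (fun l => Gamma x i i l * Gamma x l j k
                                  - Gamma x i j l * Gamma x l i k)).

Definition ricci_flat (U : (I -> R) -> Prop) (g : field2) : Prop :=
  exists Gamma, levi_civita U g Gamma /\
    forall x, U x -> forall j k, ricci Gamma x j k = 0.

(* The components of an endomorphism field are A x k i = A^k_i, so that
   A (d/dx^i) = sum_k A^k_i d/dx^k. *)
Definition almost_complex (U : (I -> R) -> Prop) (A : field2) : Prop :=
  smooth2_on U A /\
  forall x, U x -> forall k i,
    rsum (fun l => A x k l * A x l i) = - (if index_eq_dec k i then 1 else 0).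

(* Component N^k_{ij} of [AX, AY] - A[AX, Y] - A[X, AY] + A^2[X, Y]. *)
Definition nijenhuis (A : field2) : connection := fun x k i j =>
  rsum (fun l => A x l i * partial l (fun y => A y k j) x
                 - A x l j * partial l (fun y => A y k i) x
                 - A x k l * (partial i (fun y => A y l j) x
                              - partial j (fun y => A y l i) x)).

Definition complex_structure (U : (I -> R) -> Prop) (A : field2) : Prop :=
  almost_complex U A /\
  forall x, U x -> forall k i j, nijenhuis A x k i j = 0.

Definition closed2 (U : (I -> R) -> Prop) (w : field2) : Prop :=
  forall x, U x -> forall i j k,
    partial i (fun y => w y j k) x + partial j (fun y => w y k i) x
    + partial k (fun y => w y i j) x = 0.

(* g is a Kaehler metric on U with Kaehler form w(X, Y) = g(AX, Y). *)
Definition kahler_with_form (U : (I -> R) -> Prop) (g w : field2) : Prop :=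
  riemannian U g /\
  smooth2_on U w /\
  closed2 U w /\
  exists A, complex_structure U A /\
    forall x, U x -> forall i j,
      rsum (fun k => rsum (fun l => g x k l * A x k i * A x l j)) = g x i j /\
      w x i j = rsum (fun k => g x k j * A x k i).

(** * Wirtinger calculus on C^I *)

(* Derivative at a = 0 of F along a |-> z + a w e_j, a real. *)
Definition line_derivative (j : I) (w : C) (F : (I -> C) -> C) (z : I -> C)
    : C :=
  (Derive (fun a => fst (F (update z j (z j + RtoC a * w)%C))) 0,
   Derive (fun a => snd (F (update z j (z j + RtoC a * w)%C))) 0).

Definition dz (j : I) (F : (I -> C) -> C) (z : I -> C) : C :=
  ((line_derivative j (RtoC 1) F z - Ci * line_derivative j Ci F z)
     / RtoC 2)%C.

Definition dzbar (j : I) (F : (I -> C) -> C) (z : I -> C) : C :=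
  ((line_derivative j (RtoC 1) F z + Ci * line_derivative j Ci F z)
     / RtoC 2)%C.

(* g_{i j*} = d_i d_{j*} K. *)
Definition metric_of_potential (K : (I -> C) -> R) (z : I -> C) (i j : I) : C :=
  dz i (dzbar j (fun z' => RtoC (K z'))) z.

End Calculus.

(* Pull-back along Phi : R^J -> C^I of the line element
   sum_{i,j} h_{i j*} dz^i dzbar^{j*}, the product of one-forms being the
   symmetric one (alpha (x) beta + beta (x) alpha) / 2. *)
Definition pullback_hermitian {I J : Type} {FI : FinIndex I} {FJ : FinIndex J}
    (Phi : (J -> R) -> I -> C) (h : (I -> C) -> I -> I -> C)
    (y : J -> R) (a b : J) : C :=
  let dPhi (i : I) (c : J) : C :=
    (partial c (fun y' => fst (Phi y' i)) y,
     partial c (fun y' => snd (Phi y' i)) y) in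
  csum (fun i => csum (fun j =>
    h (Phi y) i j * ((dPhi i a * Cconj (dPhi j b)
                      + dPhi i b * Cconj (dPhi j a)) / RtoC 2)))%C.

(** * The orthotoric metric

   The angles phi, tau, chi range over R, i.e. we work on the universal cover
   of the torus they parametrise; [angle_invariant] says that a tensor descends
   to the quotient by the periods. *)

Definition angle_eq (period a b : R) : Prop :=
  exists k : Z, a - b = period * IZR k.

Inductive coord : Type := x_s | x_t | x_theta | x_phi | x_tau | x_chi.

#[export] Instance coord_index : FinIndex coord.
Proof.
refine {| index_enum := [x_s; x_t; x_theta; x_phi; x_tau; x_chi] |}.
- intros i j; decide equality.
- repeat constructor; simpl; intuition discriminate.
- intros []; simpl; tauto.
Defined.

Definition orthotoric_domain (x : coord -> R) : Prop :=
  x x_s < -3 /\ -(3/2) < x x_t < 0 /\ 0 < x x_theta < PI.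

Definition same_point (x x' : coord -> R) : Prop :=
  x x_s = x' x_s /\ x x_t = x' x_t /\ x x_theta = x' x_theta /\
  angle_eq (2 * PI) (x x_phi) (x' x_phi) /\
  angle_eq (2 * PI) (x x_tau) (x' x_tau) /\
  angle_eq (3 / 2 * PI) (x x_chi) (x' x_chi).

Definition angle_invariant (T : (coord -> R) -> coord -> coord -> R) : Prop :=
  forall x x', orthotoric_domain x -> orthotoric_domain x' -> same_point x x' ->
    forall i j, T x i j = T x' i j.

Definition Q (s : R) : R := 2 * s ^ 2 / 3 + s + 9 / s.

Definition eta (x : coord -> R) : coord -> R := fun i =>
  dcoord x_tau i + (1 - cos (x x_theta)) * dcoord x_phi i.

(* (p/3 + 1) dchi - (p/2) eta, to be used with p = t and p = s. *)
Definition fibre_form (p : R) (x : coord -> R) : coord -> R := fun i =>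
  (p / 3 + 1) * dcoord x_chi i - p / 2 * eta x i.

Definition orthotoric_metric (x : coord -> R) (i j : coord) : R :=
  let s := x x_s in let t := x x_t in let theta := x x_theta in
  1 / 4 * s * t * (sq (dcoord x_theta) i j
                   + sin theta ^ 2 * sq (dcoord x_phi) i j)
  + (t - s) / (4 * Q s) * sq (dcoord x_s) i j
  + 3 * (s - t) / (4 * t * (2 * t + 3)) * sq (dcoord x_t) i j
  + Q s / (t - s) * sq (fibre_form t x) i j
  + t * (2 * t + 3) / (3 * (s - t)) * sq (fibre_form s x) i j.

Definition Upsilon (s : R) : R := sqrt (- s / (2 / 3 * s ^ 2 - s + 3)).
Definition P (t : R) : R := sqrt (1 / (- (2 / 3) * t ^ 2 - t)).

Definition E1 (x : coord -> R) : coord -> R := fun i =>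
  1 / 2 * sqrt (x x_s * x x_t) * dcoord x_theta i.
Definition E2 (x : coord -> R) : coord -> R := fun i =>
  1 / 2 * sqrt (x x_s * x x_t) * sin (x x_theta) * dcoord x_phi i.
Definition E3 (x : coord -> R) : coord -> R := fun i =>
  1 / 2 * sqrt ((x x_s - x x_t) / (3 + x x_s)) * Upsilon (x x_s)
  * dcoord x_s i.
Definition E4 (x : coord -> R) : coord -> R := fun i =>
  1 / 2 * sqrt (x x_t - x x_s) * P (x x_t) * dcoord x_t i.
Definition E5 (x : coord -> R) : coord -> R := fun i =>
  - (1 / (sqrt ((x x_s - x x_t) / (3 + x x_s)) * Upsilon (x x_s)))
  * fibre_form (x x_t) x i.
Definition E6 (x : coord -> R) : coord -> R := fun i =>
  - (1 / (sqrt (x x_t - x x_s) * P (x x_t))) * fibre_form (x x_s) x i.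

Definition orthotoric_form (x : coord -> R) (i j : coord) : R :=
  wedge (E1 x) (E2 x) i j + wedge (E3 x) (E5 x) i j + wedge (E4 x) (E6 x) i j.

(** * The exceptional divisor *)

Inductive dcoords : Type := y_t | y_theta | y_phi | y_tau.

#[export] Instance dcoords_index : FinIndex dcoords.
Proof.
refine {| index_enum := [y_t; y_theta; y_phi; y_tau] |}.
- intros i j; decide equality.
- repeat constructor; simpl; intuition discriminate.
- intros []; simpl; tauto.
Defined.

Definition divisor_domain (y : dcoords -> R) : Prop :=
  -(3/2) < y y_t < 0 /\ 0 < y y_theta < PI.

(* The slice of constant s and chi: on the vectors tangent to it
   ds = 0 and dchi = 0. *)
Definition slice (s chi : R) (y : dcoords -> R) : coord -> R := fun i =>
  match i with
  | x_s => s | x_t => y y_t | x_theta => y y_theta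
  | x_phi => y y_phi | x_tau => y y_tau | x_chi => chi
  end.

Definition slice_dir (a : dcoords) : coord :=
  match a with
  | y_t => x_t | y_theta => x_theta | y_phi => x_phi | y_tau => x_tau
  end.

Definition restricts_to_divisor (g : (coord -> R) -> coord -> coord -> R)
    (h : (dcoords -> R) -> dcoords -> dcoords -> R) : Prop :=
  forall y, divisor_domain y -> forall (chi : R) (a b : dcoords),
    filterlim (fun s => g (slice s chi y) (slice_dir a) (slice_dir b))
      (at_left (-3)) (locally (h y a b)).

Definition divisor_eta (y : dcoords -> R) : dcoords -> R := fun a =>
  dcoord y_tau a + (1 - cos (y y_theta)) * dcoord y_phi a.

Definition divisor_metric (y : dcoords -> R) (a b : dcoords) : R :=
  let t := y y_t in let theta := y y_theta in
  - (3 * t / 4) * (sq (dcoord y_theta) a b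
                   + sin theta ^ 2 * sq (dcoord y_phi) a b)
  - 3 * (t + 3) / (4 * t * (2 * t + 3)) * sq (dcoord y_t) a b
  - 3 * t * (2 * t + 3) / (4 * (t + 3)) * sq (divisor_eta y) a b.

Inductive holo : Type := z_u | z_v.

#[export] Instance holo_index : FinIndex holo.
Proof.
refine {| index_enum := [z_u; z_v] |}.
- intros i j; decide equality.
- repeat constructor; simpl; intuition discriminate.
- intros []; simpl; tauto.
Defined.

Definition varpi (z : holo -> C) : R :=
  (1 + Cmod (z z_u) ^ 2) ^ 2 * Cmod (z z_v) ^ 2.

(* c is the additive constant of the potential. *)
Definition potential (c w : R) : R :=
  9 / 4 * ((3 * w + sqrt (w * (w + 8))) / (w + sqrt (w * (w + 8)))
           + ln (w + sqrt (w * (w + 8)) + 4)) + c.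

Definition kronheimer_metric (c : R) : (holo -> C) -> holo -> holo -> C :=
  metric_of_potential (fun z => potential c (varpi z)).

Definition cis (a : R) : C := (cos a, sin a).

(* t = -(2/3) varpi d_varpi K(varpi). *)
Definition moment_relation (c t w : R) : Prop :=
  t = - (2 / 3) * w * Derive (potential c) w.

Definition identified (c : R) (y : dcoords -> R) (z : holo -> C) : Prop :=
  z z_u = (RtoC (tan (y y_theta / 2)) * cis (y y_phi))%C /\
  z z_v <> RtoC 0 /\
  z z_v = (RtoC (Cmod (z z_v)) * cis (y y_tau))%C /\
  moment_relation c (y y_t) (varpi z).

Definition same_divisor_point (y y' : dcoords -> R) : Prop :=
  y y_t = y' y_t /\ y y_theta = y' y_theta /\
  angle_eq (2 * PI) (y y_phi) (y' y_phi) /\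
  angle_eq (2 * PI) (y y_tau) (y' y_tau).

(* Main.v *)
From Stdlib Require Import Lra FunctionalExtensionality.
Require Import Defs.
Import ListNotations.
Open Scope R_scope.

(** Every statement of part (1) is a set of identities between rational
    functions of s, t, sin theta and cos theta, once one knows which connection
    and which complex structure to use.  Write
    alpha = (t/3 + 1) dchi - (t/2) eta,  beta = (s/3 + 1) dchi - (s/2) eta,
    f = t (2t + 3) / 3.  The Kaehler form is
    (st/4) sin theta dtheta /\ dphi - (1/2) ds /\ alpha - (1/2) dt /\ beta,
    all square roots of the coframe having cancelled, and it is closed because
    d eta = sin theta dtheta /\ dphi.  The complex structure rotates dtheta,
    ds, dt into multiples of dphi, alpha, beta ([complex_table]).  The metric
    splits into a part in s, t, theta and a part in phi, tau, chi that depends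
    on s, t, theta only, so that its Christoffel symbols are governed by the
    endomorphisms G^-1 dG / 2 of the angular block ([shape]), which are short
    expressions in the frame dual to alpha, beta, dphi.  Coefficients are kept
    as syntactic expressions, differentiated symbolically ([is_derive_eval]);
    this yields smoothness at once ([smooth_eval]) and turns the closedness of
    the form, the vanishing of the Nijenhuis tensor, the defining property of the
    Levi-Civita connection and the vanishing of its Ricci tensor into
    finitely many identities in a field ([kahler_tabulated],
    [levi_civita_tabulated], [ricci_tabulated]), using only
    sin^2 + cos^2 = 1.

    For part (2), let x = log varpi.  With r = sqrt (varpi (varpi + 8)) one
    finds dK/dx = (9/16) (r - varpi) ([is_derive_potential]), so the moment
    relation reads t = - (3/8) (r - varpi), which is solved by
    varpi = 8 t^2 / (3 (2t + 3)) ([moment_relation_iff]).  The metric of the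
    potential is K_xx |d'x|^2 + K_x times the mixed Hessian of x
    ([kronheimer_metric_eq]), where d'x is the (1,0)-part of dx.  The Hessian
    comes from 2 log (1 + |u|^2) and is twice the Fubini-Study metric
    |du|^2 / (1 + |u|^2)^2, that is (dtheta^2 + sin^2 theta dphi^2) / 2, while
    d'x = dx/2 + i eta ([dlog_chart]).  As K_x = - (3/2) t and
    dx/dt = 2 (t + 3) / (t (2t + 3)), the three terms of the metric of the
    divisor come out ([pullback_kronheimer]). *)

(** * Elementary functions of the coordinates *)

Section Expressions.

Context {I : Type} {FI : FinIndex I}.

(** Constants are integers so that a vanishing or unit factor can be recognized
    by computation. *)
Inductive expr : Type :=
  | Cst (z : Z) | Var (i : I) | Sin (i : I) | Cos (i : I)
  | Add (a b : expr) | Mul (a b : expr) | Inv (a : expr).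

Fixpoint eval (e : expr) (x : I -> R) : R :=
  match e with
  | Cst z => IZR z
  | Var i => x i
  | Sin i => sin (x i)
  | Cos i => cos (x i)
  | Add a b => eval a x + eval b x
  | Mul a b => eval a x * eval b x
  | Inv a => / eval a x
  end.

Fixpoint defined (e : expr) (x : I -> R) : Prop :=
  match e with
  | Add a b | Mul a b => defined a x /\ defined b x
  | Inv a => defined a x /\ eval a x <> 0
  | _ => True
  end.

(** Absorbing 0 and 1 makes the vanishing components of a computed tensor
    literally [Cst 0]. *)
Definition add (a b : expr) : expr :=
  match a, b with
  | Cst 0, _ => b
  | _, Cst 0 => a
  | _, _ => Add a b
  end.

Definition mul (a b : expr) : expr :=
  match a, b with
  | Cst 0, _ | _, Cst 0 => Cst 0
  | Cst 1, _ => b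
  | _, Cst 1 => a
  | _, _ => Mul a b
  end.

Definition opp (a : expr) : expr := mul (Cst (-1)) a.

Definition sub (a b : expr) : expr := add a (opp b).

Definition esum (F : I -> expr) : expr :=
  fold_right (fun i acc => add (F i) acc) (Cst 0) index_enum.

Fixpoint deriv (i : I) (e : expr) : expr :=
  match e with
  | Cst _ => Cst 0
  | Var j => if index_eq_dec i j then Cst 1 else Cst 0
  | Sin j => if index_eq_dec i j then Cos j else Cst 0
  | Cos j => if index_eq_dec i j then opp (Sin j) else Cst 0
  | Add a b => add (deriv i a) (deriv i b)
  | Mul a b => add (mul (deriv i a) b) (mul a (deriv i b))
  | Inv a => mul (opp (deriv i a)) (Mul (Inv a) (Inv a))
  end.

Lemma eval_add a b x : eval (add a b) x = eval a x + eval b x.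
Proof. destruct a as [[]| | | | | |], b as [[]| | | | | |]; simpl; ring. Qed.

Lemma eval_mul a b x : eval (mul a b) x = eval a x * eval b x.
Proof.
destruct a as [[|[]|]| | | | | |], b as [[|[]|]| | | | | |]; simpl; ring.
Qed.

Lemma eval_sub a b x : eval (sub a b) x = eval a x - eval b x.
Proof. unfold sub, opp; rewrite eval_add, eval_mul; simpl; ring. Qed.

Lemma eval_esum F x : eval (esum F) x = rsum (fun i => eval (F i) x).
Proof.
unfold esum, rsum; induction index_enum as [|i l IH]; simpl; [reflexivity|].
now rewrite eval_add, IH.
Qed.

Lemma defined_add a b x : defined a x -> defined b x -> defined (add a b) x.
Proof.
destruct a as [[]| | | | | |], b as [[]| | | | | |]; simpl; tauto.
Qed.

Lemma defined_mul a b x : defined a x -> defined b x -> defined (mul a b) x.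
Proof.
destruct a as [[|[]|]| | | | | |], b as [[|[]|]| | | | | |]; simpl; tauto.
Qed.

Lemma defined_deriv i e x : defined e x -> defined (deriv i e) x.
Proof.
induction e; simpl; try destruct (index_eq_dec i i0); simpl; trivial;
  unfold opp; intros H; repeat apply defined_add || apply defined_mul;
  simpl; tauto.
Qed.

Lemma update_same {V : Type} (x : I -> V) i a : update x i a i = a.
Proof. unfold update; now destruct (index_eq_dec i i). Qed.

Lemma update_other {V : Type} (x : I -> V) i j a : i <> j -> update x i a j = x j.
Proof. unfold update; now destruct (index_eq_dec i j). Qed.

Lemma eval_update_id e x i : eval e (update x i (x i)) = eval e x.
Proof.
assert (H : forall j, update x i (x i) j = x j).
{ intros j; unfold update; destruct (index_eq_dec i j) as [<-|]; reflexivity. }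
induction e; simpl; congruence.
Qed.

Lemma is_derive_coord x i j :
  is_derive (fun a => update x i a j) (x i) (if index_eq_dec i j then 1 else 0).
Proof.
unfold update; destruct (index_eq_dec i j); [auto_derive; trivial | apply @is_derive_const].
Qed.

Lemma is_derive_eval i e x : defined e x ->
  is_derive (fun a => eval e (update x i a)) (x i) (eval (deriv i e) x).
Proof.
induction e as [z|j|j|j|e1 IH1 e2 IH2|e1 IH1 e2 IH2|e IH]; simpl.
- intros _; apply @is_derive_const.
- intros _; generalize (is_derive_coord x i j); now destruct (index_eq_dec i j).
- intros _; destruct (index_eq_dec i j) as [<-|n]; simpl.
  + apply is_derive_ext with (f := sin);
      [now intros a; rewrite update_same | apply is_derive_sin].
  + apply is_derive_ext with (f := fun _ => sin (x j));
      [now intros a; rewrite update_other | apply @is_derive_const].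
- intros _; destruct (index_eq_dec i j) as [<-|n]; simpl.
  + replace (-1 * sin (x i)) with (- sin (x i)) by ring.
    apply is_derive_ext with (f := cos);
      [now intros a; rewrite update_same | apply is_derive_cos].
  + apply is_derive_ext with (f := fun _ => cos (x j));
      [now intros a; rewrite update_other | apply @is_derive_const].
- intros [H1 H2]; rewrite eval_add; apply @is_derive_plus; auto.
- intros [H1 H2]; rewrite eval_add, !eval_mul.
  rewrite <- (eval_update_id e1 x i); rewrite <- (eval_update_id e2 x i).
  apply (is_derive_mult (fun a => eval e1 (update x i a))
           (fun a => eval e2 (update x i a))); auto.
  intros n m; apply Rmult_comm.
- intros [H1 H2].
  unfold opp; rewrite !eval_mul; simpl.
  replace (-1 * eval (deriv i e) x * (/ eval e x * / eval e x))
    with (- eval (deriv i e) x / eval e (update x i (x i)) ^ 2)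
    by (rewrite eval_update_id; field; trivial).
  apply is_derive_inv; [auto | now rewrite eval_update_id].
Qed.

Lemma partial_eval i e x : defined e x ->
  partial i (eval e) x = eval (deriv i e) x.
Proof. intros H; apply is_derive_unique; now apply is_derive_eval. Qed.

Lemma continuous_coord (x : I -> R) i :
  continuous (T := fct_UniformSpace I R_UniformSpace) (U := R_UniformSpace)
    (fun y : I -> R => y i) x.
Proof.
intros Q0 [eps H]; exists eps; intros y Hy; apply H, Hy.
Qed.

Lemma continuous_eval e x : defined e x ->
  continuous (T := fct_UniformSpace I R_UniformSpace) (U := R_UniformSpace)
    (eval e) x.
Proof.
induction e as [z|j|j|j|e1 IH1 e2 IH2|e1 IH1 e2 IH2|e IH]; simpl.
- intros _; apply @continuous_const.
- intros _; apply continuous_coord.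
- intros _.
  apply (continuous_comp (U := fct_UniformSpace I R_UniformSpace)
           (fun y : I -> R => y j) sin);
    [apply continuous_coord | apply continuous_sin].
- intros _.
  apply (continuous_comp (U := fct_UniformSpace I R_UniformSpace)
           (fun y : I -> R => y j) cos);
    [apply continuous_coord | apply continuous_cos].
- intros [H1 H2].
  apply (continuous_plus (U := fct_UniformSpace I R_UniformSpace)
           (V := R_NormedModule) (eval e1) (eval e2)); auto.
- intros [H1 H2].
  apply (continuous_mult (U := fct_UniformSpace I R_UniformSpace)
           (K := R_AbsRing) (eval e1) (eval e2)); auto.
- intros [H1 H2].
  apply (continuous_comp (U := fct_UniformSpace I R_UniformSpace) (eval e) Rinv); [auto|].
  now apply continuous_Rinv.
Qed.

Definition open_region (U : (I -> R) -> Prop) : Prop :=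
  forall x, U x -> locally (T := fct_UniformSpace I R_UniformSpace) x U.

Lemma open_along_line U x i : open_region U -> U x ->
  locally (x i) (fun a => U (update x i a)).
Proof.
intros HU Hx; destruct (HU x Hx) as [eps H]; exists eps; intros a Ha.
apply H; intros j; unfold update; destruct (index_eq_dec i j) as [<-|];
  [exact Ha | apply ball_center].
Qed.

Lemma partial_ext U f g i x : open_region U -> U x ->
  (forall y, U y -> f y = g y) -> partial i f x = partial i g x.
Proof.
intros HU Hx E; apply Derive_ext_loc.
generalize (open_along_line U x i HU Hx); apply filter_imp; auto.
Qed.

(** The class of expressions defined on U is stable under [deriv], so all iterated
    partial derivatives stay in it.  Openness is what lets a partial derivative
    be computed from the values on U alone. *)
Lemma smooth_eval U f e : open_region U ->
  (forall x, U x -> defined e x) -> (forall x, U x -> f x = eval e x) ->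
  smooth_on U f.
Proof.
intros HU Hd Hf l.
assert (H : exists e', (forall x, U x -> defined e' x) /\
              forall x, U x -> partials l f x = eval e' x).
{ induction l as [|i l [e' [H1 H2]]]; [now exists e|].
  exists (deriv i e'); split.
  - intros x Hx; apply defined_deriv; auto.
  - intros x Hx; simpl; rewrite <- partial_eval by auto.
    now apply partial_ext with U. }
destruct H as [e' [H1 H2]]; intros x Hx; split.
- apply continuous_ext_loc with (eval e').
  + generalize (HU x Hx); apply filter_imp; intros y Hy; symmetry; auto.
  + apply continuous_eval; auto.
- intros i; exists (eval (deriv i e') x).
  apply is_derive_ext_loc with (fun a => eval e' (update x i a)).
  + generalize (open_along_line U x i HU Hx); apply filter_imp;
      intros y Hy; symmetry; auto.
  + apply is_derive_eval; auto.
Qed.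

(** * Tensor fields given by tables of expressions *)

Definition covector : Type := I -> expr.
Definition table2 : Type := I -> I -> expr.
Definition table3 : Type := I -> I -> I -> expr.

Definition tabulates (U : (I -> R) -> Prop) (E : table2) (T : field2) : Prop :=
  (forall x i j, U x -> defined (E i j) x) /\
  (forall x i j, U x -> T x i j = eval (E i j) x).

(** dx^i, and also the coordinate vector d/dx^i. *)
Definition coframe (i : I) : covector :=
  fun j => if index_eq_dec i j then Cst 1 else Cst 0.

Definition combine (a : expr) (u : covector) (b : expr) (v : covector) : covector :=
  fun i => add (mul a (u i)) (mul b (v i)).

(** The sum of the a u (x) v over the triples (a, u, v) of l.  For an endomorphism
    field u is a vector and v a covector. *)
Definition tensor_sum (l : list (expr * covector * covector)) : table2 :=
  fun i j =>
  fold_right (fun '(a, u, v) acc => add (mul a (mul (u i) (v j))) acc) (Cst 0) l.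

Definition wedge_table (u v : covector) : table2 := fun i j =>
  sub (mul (u i) (v j)) (mul (u j) (v i)).

Definition nonmetricity_table (g : table2) (G : table3) : table3 := fun k i j =>
  sub (deriv k (g i j))
      (esum (fun l => add (mul (G l k i) (g l j)) (mul (G l k j) (g i l)))).

Definition ricci_table (G : table3) : table2 := fun j k =>
  add (esum (fun i => sub (deriv i (G i j k)) (deriv j (G i i k))))
      (esum (fun i => esum (fun l =>
         sub (mul (G i i l) (G l j k)) (mul (G i j l) (G l i k))))).

Definition exterior_table (w : table2) : table3 := fun i j k =>
  add (add (deriv i (w j k)) (deriv j (w k i))) (deriv k (w i j)).

Definition nijenhuis_table (A : table2) : table3 := fun k i j =>
  esum (fun l => sub (sub (mul (A l i) (deriv l (A k j)))
                          (mul (A l j) (deriv l (A k i))))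
                     (mul (A k l) (sub (deriv i (A l j)) (deriv j (A l i))))).

Definition product_table (A B : table2) : table2 := fun k i =>
  esum (fun l => mul (A k l) (B l i)).

(** The bilinear form (X, Y) |-> g(AX, Y). *)
Definition lower_table (g A : table2) : table2 := fun i j =>
  esum (fun k => mul (g k j) (A k i)).

(** The bilinear form (X, Y) |-> g(AX, AY). *)
Definition conjugate_table (g A : table2) : table2 := fun i j =>
  esum (fun k => esum (fun l => mul (mul (g k l) (A k i)) (A l j))).

Lemma eval_coframe i j x : eval (coframe i j) x = if index_eq_dec i j then 1 else 0.
Proof. unfold coframe; now destruct (index_eq_dec i j). Qed.

Lemma rsum_ext (F G : I -> R) : (forall i, F i = G i) -> rsum F = rsum G.
Proof.
intros H; unfold rsum; induction index_enum; simpl; congruence.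
Qed.

Lemma tabulates_eval U E : (forall x i j, U x -> defined (E i j) x) ->
  tabulates U E (fun x i j => eval (E i j) x).
Proof. now split. Qed.

Lemma tabulates_smooth U E T : open_region U -> tabulates U E T -> smooth2_on U T.
Proof.
intros HU [D V] i j; apply smooth_eval with (E i j); auto.
Qed.

Lemma partial_tabulated U E T k x i j : open_region U -> tabulates U E T -> U x ->
  partial k (fun y => T y i j) x = eval (deriv k (E i j)) x.
Proof.
intros HU [D V] Hx; rewrite <- partial_eval by auto.
apply partial_ext with U; auto.
Qed.

Lemma levi_civita_tabulated U E T G : open_region U -> tabulates U E T ->
  (forall x k i j, U x -> eval (G k i j) x = eval (G k j i) x) ->
  (forall x k i j, U x -> eval (nonmetricity_table E G k i j) x = 0) ->
  levi_civita U T (fun x k i j => eval (G k i j) x).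
Proof.
intros HU HT Hsym Hg x Hx; split; [now intros; apply Hsym|].
intros k i j; rewrite (partial_tabulated U E) by trivial.
assert (H := Hg x k i j Hx).
unfold nonmetricity_table in H; rewrite eval_sub, eval_esum in H.
apply Rminus_diag_uniq in H; rewrite H; apply rsum_ext; intros l.
destruct HT as [_ V]; now rewrite eval_add, !eval_mul, !V.
Qed.

Lemma ricci_tabulated G x : (forall k i j, defined (G k i j) x) -> forall j k,
  ricci (fun y l i m => eval (G l i m) y) x j k = eval (ricci_table G j k) x.
Proof.
intros D j k; unfold ricci, ricci_table; rewrite eval_add, !eval_esum; f_equal.
- apply rsum_ext; intros i; rewrite eval_sub.
  f_equal; [|f_equal]; now apply (partial_eval _ (G _ _ _)).
- apply rsum_ext; intros i; rewrite eval_esum; apply rsum_ext; intros l.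
  now rewrite eval_sub, !eval_mul.
Qed.

Lemma closed2_tabulated U E T : open_region U -> tabulates U E T ->
  (forall x i j k, U x -> eval (exterior_table E i j k) x = 0) -> closed2 U T.
Proof.
intros HU HT H x Hx i j k; rewrite <- (H x i j k Hx).
unfold exterior_table; rewrite !eval_add.
now rewrite !(partial_tabulated U E) by trivial.
Qed.

Lemma nijenhuis_tabulated U E T : open_region U -> tabulates U E T ->
  forall x k i j, U x -> nijenhuis T x k i j = eval (nijenhuis_table E k i j) x.
Proof.
intros HU HT x k i j Hx; unfold nijenhuis, nijenhuis_table.
rewrite eval_esum; apply rsum_ext; intros l.
rewrite !(partial_tabulated U E) by trivial.
destruct HT as [_ V]; now rewrite !V, !eval_sub, !eval_mul, eval_sub.
Qed.

Lemma kahler_tabulated U g w Eg Ew EA : open_region U -> riemannian U g ->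
  tabulates U Eg g -> tabulates U Ew w ->
  (forall x k i, U x -> defined (EA k i) x) ->
  (forall x i j k, U x -> eval (exterior_table Ew i j k) x = 0) ->
  (forall x k i, U x ->
     eval (product_table EA EA k i) x = eval (opp (coframe k i)) x) ->
  (forall x k i j, U x -> eval (nijenhuis_table EA k i j) x = 0) ->
  (forall x i j, U x -> eval (conjugate_table Eg EA i j) x = eval (Eg i j) x) ->
  (forall x i j, U x -> eval (lower_table Eg EA i j) x = eval (Ew i j) x) ->
  kahler_with_form U g w.
Proof.
intros HU Hg Tg Tw DA Hd HA2 HN Hherm Hform.
assert (TA := tabulates_eval U EA DA).
split; [trivial|split; [now apply tabulates_smooth with Ew|split]].
{ now apply closed2_tabulated with Ew. }
exists (fun x k i => eval (EA k i) x); split; [split; [split|]|].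
- now apply tabulates_smooth with EA.
- intros x Hx k i; assert (H := HA2 x k i Hx).
  unfold product_table, opp in H.
  rewrite eval_esum, eval_mul, eval_coframe in H; simpl in H.
  replace (- (if index_eq_dec k i then 1 else 0))
    with (-1 * (if index_eq_dec k i then 1 else 0)) by ring.
  rewrite <- H; apply rsum_ext; intros l; now rewrite eval_mul.
- intros x Hx k i j; rewrite (nijenhuis_tabulated U EA); auto.
- destruct Tg as [_ Vg], Tw as [_ Vw]; intros x Hx i j; split.
  + rewrite Vg, <- Hherm by trivial; unfold conjugate_table.
    rewrite eval_esum; apply rsum_ext; intros k.
    rewrite eval_esum; apply rsum_ext; intros l.
    now rewrite !eval_mul, Vg.
  + rewrite Vw, <- Hform by trivial; unfold lower_table.
    rewrite eval_esum; apply rsum_ext; intros k.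
    now rewrite eval_mul, Vg.
Qed.

End Expressions.

Declare Scope expr_scope.
Delimit Scope expr_scope with E.
Infix "+" := add : expr_scope.
Infix "-" := sub : expr_scope.
Infix "*" := mul : expr_scope.

(** * Tables of the orthotoric geometry *)

Local Notation Xs := (Var x_s).
Local Notation Xt := (Var x_t).
Local Notation Xsin := (Sin x_theta).
Local Notation Xcos := (Cos x_theta).

Definition inv_gap : expr := Inv (Xs - Xt)%E.

Definition half : @expr coord := Inv (Cst 2).
Definition quarter : @expr coord := (half * half)%E.
Definition third : @expr coord := Inv (Cst 3).

(** The function Q, factored so that the pole s = -3 of its inverse is explicit. *)
Definition q : expr :=
  (third * (Xs + Cst 3) * (Cst 2 * Xs * Xs - Cst 3 * Xs + Cst 9) * Inv Xs)%E.
Definition inv_q : expr :=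
  (Cst 3 * Xs * Inv (Xs + Cst 3) * Inv (Cst 2 * Xs * Xs - Cst 3 * Xs + Cst 9))%E.

(** The counterpart of Q for the variable t: dt^2 has the coefficient
    (s - t) / (4 f) and beta^2 the coefficient f / (s - t). *)
Definition f : expr := (third * Xt * (Cst 2 * Xt + Cst 3))%E.
Definition inv_f : expr := (Cst 3 * Inv Xt * Inv (Cst 2 * Xt + Cst 3))%E.

Definition eta_table : covector :=
  combine (Cst 1) (coframe x_tau) (Cst 1 - Xcos)%E (coframe x_phi).
Definition fibre_table (p : expr) : covector :=
  combine (third * p + Cst 1)%E (coframe x_chi) (Cst (-1) * half * p)%E eta_table.
Definition alpha : covector := fibre_table Xt.
Definition beta : covector := fibre_table Xs.
Definition dphi : covector := coframe x_phi.

(** This vector spans the kernel of [fibre_table p] among the vectors without dphi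
    component, since eta takes the value 2p/3 + 2 on it.  Its rescalings [V_alpha],
    [V_beta] and the vector [V_phi] form the basis of the angular directions dual
    to alpha, beta, dphi. *)
Definition fibre_vector (p : expr) : covector :=
  combine p (coframe x_chi) (Cst 2 * third * p + Cst 2)%E (coframe x_tau).
Definition V_alpha : covector := fun i => (inv_gap * fibre_vector Xs i)%E.
Definition V_beta : covector := fun i => (Cst (-1) * inv_gap * fibre_vector Xt i)%E.
Definition V_phi : covector :=
  combine (Cst 1) (coframe x_phi) (Xcos - Cst 1)%E (coframe x_tau).

(** The metric is sum_a h_a (dx^a)^2 + sum G_mn dy^m dy^n with a in {s, t, theta},
    m, n in {phi, tau, chi}, and h_a, G_mn functions of s, t, theta. *)
Definition is_base (a : coord) : bool :=
  match a with x_s | x_t | x_theta => true | _ => false end.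

Definition base_coeff (a : coord) : expr :=
  match a with
  | x_s => Cst (-1) * quarter * inv_q * (Xs - Xt)
  | x_t => quarter * inv_f * (Xs - Xt)
  | x_theta => quarter * Xs * Xt
  | _ => Cst 0
  end%E.

Definition inv_base_coeff (a : coord) : expr :=
  match a with
  | x_s => Cst (-4) * q * inv_gap
  | x_t => Cst 4 * f * inv_gap
  | x_theta => Cst 4 * Inv Xs * Inv Xt
  | _ => Cst 0
  end%E.

Definition metric_table : table2 := tensor_sum
  [ (base_coeff x_s, coframe x_s, coframe x_s);
    (base_coeff x_t, coframe x_t, coframe x_t);
    (base_coeff x_theta, coframe x_theta, coframe x_theta);
    (base_coeff x_theta * Xsin * Xsin, dphi, dphi);
    (Cst (-1) * q * inv_gap, alpha, alpha);
    (f * inv_gap, beta, beta) ]%E.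

Definition form_table : table2 := fun i j =>
  (quarter * Xs * Xt * Xsin * wedge_table (coframe x_theta) dphi i j
   - half * wedge_table (coframe x_s) alpha i j
   - half * wedge_table (coframe x_t) beta i j)%E.

(** The structure sends e_1, e_3, e_4 to e_2, e_5, e_6 for the frame e dual to the
    coframe E of the Kaehler form; its coefficients are the ratios of the
    coefficients of paired covectors. *)
Definition complex_table : table2 := tensor_sum
  [ (Inv Xsin, V_phi, coframe x_theta);
    (Cst (-1) * Xsin, coframe x_theta, dphi);
    (half * (Xs - Xt) * inv_q, V_alpha, coframe x_s);
    (Cst (-2) * inv_gap * q, coframe x_s, alpha);
    (Cst (-1) * half * (Xs - Xt) * inv_f, V_beta, coframe x_t);
    (Cst 2 * inv_gap * f, coframe x_t, beta) ]%E.

(** The endomorphism (G^-1 d_a G) / 2 of the angular block.  In the basis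
    alpha, beta, dphi the matrix of G is diagonal; the off-diagonal terms stem
    from d_s beta = d_t alpha = (beta - alpha) / (s - t) and
    d_theta eta = sin theta dphi. *)
Definition shape (a : coord) : table2 :=
  match a with
  | x_s => tensor_sum
      [ (half * (inv_q * deriv x_s q - inv_gap), V_alpha, alpha);
        (half * inv_gap, V_beta, beta);
        (half * inv_gap * f * inv_q, V_alpha, beta);
        (Cst (-1) * half * inv_gap, V_beta, alpha);
        (half * Inv Xs, V_phi, dphi) ]
  | x_t => tensor_sum
      [ (half * (inv_f * deriv x_t f + inv_gap), V_beta, beta);
        (Cst (-1) * half * inv_gap, V_alpha, alpha);
        (half * inv_gap, V_alpha, beta);
        (Cst (-1) * half * inv_gap * q * inv_f, V_beta, alpha);
        (half * Inv Xt, V_phi, dphi) ]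
  | x_theta => tensor_sum
      [ (Cst (-1) * quarter * Xt * Xsin, V_alpha, dphi);
        (Cst (-1) * quarter * Xs * Xsin, V_beta, dphi);
        (inv_gap * q * Inv Xs * Inv Xsin, V_phi, alpha);
        (Cst (-1) * inv_gap * f * Inv Xt * Inv Xsin, V_phi, beta);
        (Xcos * Inv Xsin, V_phi, dphi) ]
  | _ => tensor_sum []
  end%E.

(** The Levi-Civita connection of a metric h_a (dx^a)^2 + G_mn dy^m dy^n whose
    coefficients do not depend on y: the symbols of h on the base,
    Gamma^a_mn = - (1/2) h_a^-1 d_a G_mn, and Gamma^m_an = (G^-1 d_a G)^m_n / 2. *)
Definition christoffel_table : table3 := fun k i j =>
  match is_base k, is_base i, is_base j with
  | true, true, true =>
      half * inv_base_coeff k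
      * (coframe k i * deriv j (base_coeff k) + coframe k j * deriv i (base_coeff k)
         - coframe i j * deriv k (base_coeff i))
  | true, false, false =>
      Cst (-1) * half * inv_base_coeff k * deriv k (metric_table i j)
  | false, true, false => shape i k j
  | false, false, true => shape j k i
  | _, _, _ => Cst 0
  end%E.

(** * The identities of the orthotoric geometry *)

Ltac normalize_expr e :=
  let e' := eval vm_compute in e in change e with e'.

(** The denominators occurring in the tables, in the form in which [eval] displays
    them, and the relation that the sine and the cosine satisfy. *)
Lemma nonzero_facts x : orthotoric_domain x ->
  x x_s <> 0 /\ x x_s + 3 <> 0 /\
  2 * x x_s * x x_s + -1 * (3 * x x_s) + 9 <> 0 /\
  x x_t <> 0 /\ 2 * x x_t + 3 <> 0 /\ x x_s + -1 * x x_t <> 0 /\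
  sin (x x_theta) <> 0 /\
  sin (x x_theta) * sin (x x_theta) = 1 - cos (x x_theta) * cos (x x_theta).
Proof.
intros [Hs [Ht Hth]]; repeat split; try lra; try nra.
- apply Rgt_not_eq, sin_gt_0; lra.
- generalize (sin2_cos2 (x x_theta)); unfold Rsqr; lra.
Qed.

(* Both sides are computed symbolically, then compared as rational functions of
   s, t, sin theta, cos theta modulo sin^2 = 1 - cos^2. *)
Ltac expr_identity x Hx :=
  lazymatch goal with
  | |- eval ?a _ = eval ?b _ => normalize_expr a; normalize_expr b
  | |- eval ?a _ = _ => normalize_expr a
  end;
  cbn [eval]; try reflexivity;
  generalize (nonzero_facts x Hx); clear Hx;
  generalize (cos (x x_theta)) (sin (x x_theta)) (x x_s) (x x_t);
  intros c S s t (Hs & Hs3 & Hq & Ht & Ht3 & Hst & HS & HSc);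
  field [HSc]; repeat split; assumption || lra.

Ltac expr_defined x Hx :=
  match goal with |- defined ?e _ => normalize_expr e end;
  cbn [defined eval]; decompose [and] (nonzero_facts x Hx);
  repeat split; assumption || lra.

Lemma metric_defined x i j : orthotoric_domain x -> defined (metric_table i j) x.
Proof. intros Hx; destruct i, j; expr_defined x Hx. Qed.

Lemma form_defined x i j : orthotoric_domain x -> defined (form_table i j) x.
Proof. intros Hx; destruct i, j; expr_defined x Hx. Qed.

Lemma complex_defined x k i : orthotoric_domain x -> defined (complex_table k i) x.
Proof. intros Hx; destruct k, i; expr_defined x Hx. Qed.

Lemma christoffel_defined x k i j : orthotoric_domain x ->
  defined (christoffel_table k i j) x.
Proof. intros Hx; destruct k, i, j; expr_defined x Hx. Qed.

Lemma christoffel_sym x k i j : orthotoric_domain x ->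
  eval (christoffel_table k i j) x = eval (christoffel_table k j i) x.
Proof. intros Hx; destruct k, i, j; expr_identity x Hx. Qed.

Lemma christoffel_metric x k i j : orthotoric_domain x ->
  eval (nonmetricity_table metric_table christoffel_table k i j) x = 0.
Proof. intros Hx; destruct k, i, j; expr_identity x Hx. Qed.

Lemma christoffel_ricci x j k : orthotoric_domain x ->
  eval (ricci_table christoffel_table j k) x = 0.
Proof. intros Hx; destruct j, k; expr_identity x Hx. Qed.

Lemma form_closed x i j k : orthotoric_domain x ->
  eval (exterior_table form_table i j k) x = 0.
Proof. intros Hx; destruct i, j, k; expr_identity x Hx. Qed.

Lemma complex_square x k i : orthotoric_domain x ->
  eval (product_table complex_table complex_table k i) x
  = eval (opp (coframe k i)) x.
Proof. intros Hx; destruct k, i; expr_identity x Hx. Qed.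

Lemma complex_integrable x k i j : orthotoric_domain x ->
  eval (nijenhuis_table complex_table k i j) x = 0.
Proof. intros Hx; destruct k, i, j; expr_identity x Hx. Qed.

Lemma complex_hermitian x i j : orthotoric_domain x ->
  eval (conjugate_table metric_table complex_table i j) x = eval (metric_table i j) x.
Proof. intros Hx; destruct i, j; expr_identity x Hx. Qed.

Lemma complex_form x i j : orthotoric_domain x ->
  eval (lower_table metric_table complex_table i j) x = eval (form_table i j) x.
Proof. intros Hx; destruct i, j; expr_identity x Hx. Qed.

(** * The orthotoric metric is Kaehler and Ricci-flat *)

Lemma locally_coord_lt {I : Type} (x : I -> R) i a : x i < a ->
  locally (T := fct_UniformSpace I R_UniformSpace) x (fun y => y i < a).
Proof. intros H; exact (continuous_coord x i _ (open_lt a _ H)). Qed.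

Lemma locally_coord_gt {I : Type} (x : I -> R) i a : a < x i ->
  locally (T := fct_UniformSpace I R_UniformSpace) x (fun y => a < y i).
Proof. intros H; exact (continuous_coord x i _ (open_gt a _ H)). Qed.

Lemma orthotoric_domain_open : open_region orthotoric_domain.
Proof.
intros x (Hs & [Ht Ht'] & [Hth Hth']).
repeat apply filter_and; now apply locally_coord_lt || apply locally_coord_gt.
Qed.

Lemma Rdiv_neg_neg a b : a < 0 -> b < 0 -> 0 < a / b.
Proof.
intros Ha Hb; replace (a / b) with (- a / - b) by (field; lra).
apply Rdiv_lt_0_compat; lra.
Qed.

Lemma Q_factored s : s <> 0 -> Q s = (s + 3) * (2 * s * s - 3 * s + 9) / (3 * s).
Proof. intros H; unfold Q; field; trivial. Qed.

Lemma orthotoric_metric_tabulated :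
  tabulates orthotoric_domain metric_table orthotoric_metric.
Proof.
split; [intros; now apply metric_defined|].
intros x i j Hx; unfold orthotoric_metric, fibre_form, eta, sq, dcoord.
rewrite Q_factored by apply (nonzero_facts x Hx).
destruct i, j;
  match goal with |- _ = eval ?e _ => normalize_expr e end;
  cbn [eval index_eq_dec coord_index coord_rec coord_rect];
  decompose [and] (nonzero_facts x Hx); field; repeat split; assumption || lra.
Qed.

(** In E3 /\ E5 and E4 /\ E6 the square roots are mutually inverse, and
    E1 /\ E2 contains the square of sqrt (st): the form is polynomial in s, t. *)
Lemma orthotoric_form_eq x i j : orthotoric_domain x ->
  orthotoric_form x i j =
  1 / 4 * (x x_s * x x_t) * sin (x x_theta) * wedge (dcoord x_theta) (dcoord x_phi) i j
  - 1 / 2 * wedge (dcoord x_s) (fibre_form (x x_t) x) i j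
  - 1 / 2 * wedge (dcoord x_t) (fibre_form (x x_s) x) i j.
Proof.
intros (Hs & Ht & Hth).
assert (R2 : sqrt (x x_s * x x_t) * sqrt (x x_s * x x_t) = x x_s * x x_t)
  by (apply sqrt_sqrt; nra).
assert (A0 : 0 < sqrt ((x x_s - x x_t) / (3 + x x_s))).
{ apply sqrt_lt_R0, Rdiv_neg_neg; lra. }
assert (B0 : 0 < sqrt (x x_t - x x_s)) by (apply sqrt_lt_R0; lra).
assert (U0 : 0 < Upsilon (x x_s)) by (apply sqrt_lt_R0, Rdiv_lt_0_compat; nra).
assert (P0 : 0 < P (x x_t)) by (apply sqrt_lt_R0, Rdiv_lt_0_compat; nra).
unfold orthotoric_form, wedge, E1, E2, E3, E4, E5, E6.
revert R2 A0 B0 U0 P0.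
generalize (sqrt (x x_s * x x_t)) (sqrt ((x x_s - x x_t) / (3 + x x_s)))
  (sqrt (x x_t - x x_s)) (Upsilon (x x_s)) (P (x x_t)).
intros r a b u p R2 A0 B0 U0 P0; rewrite <- R2; field; repeat split; lra.
Qed.

Lemma orthotoric_form_tabulated :
  tabulates orthotoric_domain form_table orthotoric_form.
Proof.
split; [intros; now apply form_defined|].
intros x i j Hx; rewrite orthotoric_form_eq by trivial.
unfold wedge, fibre_form, eta, dcoord.
destruct i, j;
  match goal with |- _ = eval ?e _ => normalize_expr e end;
  cbn [eval index_eq_dec coord_index coord_rec coord_rect]; field.
Qed.

Lemma Q_pos s : s < -3 -> 0 < Q s.
Proof.
intros H; rewrite Q_factored by lra.
replace ((s + 3) * (2 * s * s - 3 * s + 9) / (3 * s))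
  with ((- s - 3) * (2 * s * s - 3 * s + 9) / (- (3 * s))) by (field; lra).
apply Rdiv_lt_0_compat; [apply Rmult_lt_0_compat; nra | lra].
Qed.

Lemma sum_squares_pos {J : Type} (c v : J -> R) (l : list J) :
  (forall j, In j l -> 0 < c j) -> (exists j, In j l /\ v j <> 0) ->
  0 < fold_right (fun j acc => c j * v j ^ 2 + acc) 0 l.
Proof.
intros Hc [j [Hj Hv]].
assert (N : forall l', (forall j, In j l' -> 0 < c j) ->
  0 <= fold_right (fun j acc => c j * v j ^ 2 + acc) 0 l').
{ induction l' as [|k l' IH]; simpl; intros H; [lra|].
  assert (0 < c k) by auto; assert (0 <= v k ^ 2) by apply pow2_ge_0.
  assert (0 <= fold_right (fun j acc => c j * v j ^ 2 + acc) 0 l') by auto.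
  simpl in *; nra. }
induction l as [|k l IH]; [easy|]; simpl in Hj |- *.
assert (0 < c k) by (apply Hc; now left); assert (V := pow2_ge_0 (v k)).
destruct Hj as [<-|Hj].
- assert (K := N l (fun j H => Hc j (or_intror H))).
  assert (0 < v k ^ 2) by now apply pow2_gt_0.
  simpl in *; nra.
- assert (0 < fold_right (fun j acc => c j * v j ^ 2 + acc) 0 l).
  { apply IH; trivial; intros j' H'; apply Hc; now right. }
  simpl in *; nra.
Qed.

(** The six coefficients of the metric as a sum of squares of the covectors in
    [orthotoric_component]; the slots tau and chi stand for alpha and beta. *)
Definition orthotoric_coeff (x : coord -> R) (k : coord) : R :=
  let s := x x_s in let t := x x_t in
  match k with
  | x_s => (t - s) / (4 * Q s)
  | x_t => 3 * (s - t) / (4 * t * (2 * t + 3))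
  | x_theta => 1 / 4 * s * t
  | x_phi => 1 / 4 * s * t * sin (x x_theta) ^ 2
  | x_tau => Q s / (t - s)
  | x_chi => t * (2 * t + 3) / (3 * (s - t))
  end.

Definition orthotoric_component (x X : coord -> R) (k : coord) : R :=
  match k with
  | x_tau => rsum (fun i => fibre_form (x x_t) x i * X i)
  | x_chi => rsum (fun i => fibre_form (x x_s) x i * X i)
  | _ => X k
  end.

Lemma orthotoric_metric_quadratic x X :
  rsum (fun i => rsum (fun j => orthotoric_metric x i j * X i * X j)) =
  rsum (fun k => orthotoric_coeff x k * orthotoric_component x X k ^ 2).
Proof.
unfold orthotoric_coeff, orthotoric_metric; cbv zeta.
generalize ((x x_t - x x_s) / (4 * Q (x x_s)))
  (3 * (x x_s - x x_t) / (4 * x x_t * (2 * x x_t + 3)))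
  (Q (x x_s) / (x x_t - x x_s))
  (x x_t * (2 * x x_t + 3) / (3 * (x x_s - x x_t))).
intros c1 c2 c3 c4.
unfold orthotoric_component, fibre_form, eta, sq, dcoord, rsum; simpl; ring.
Qed.

Lemma orthotoric_component_inj x X : orthotoric_domain x ->
  (forall k, orthotoric_component x X k = 0) -> forall i, X i = 0.
Proof.
intros (Hs & Ht & _) H.
assert (H1 := H x_s); assert (H2 := H x_t); assert (H3 := H x_theta).
assert (H4 := H x_phi); assert (Ha := H x_tau); assert (Hb := H x_chi).
unfold orthotoric_component, fibre_form, eta, dcoord, rsum in *; simpl in *.
rewrite H1, H2, H3, H4 in Ha, Hb.
(* s alpha - t beta = (s - t) dchi on the vectors without s, t, theta, phi part *)
assert (Hchi : X x_chi = 0).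
{ apply Rmult_eq_reg_l with (x x_s - x x_t); [|lra]; nra. }
rewrite Hchi in Ha, Hb.
assert (Htau : X x_tau = 0) by nra.
intros []; trivial.
Qed.

Lemma orthotoric_riemannian : riemannian orthotoric_domain orthotoric_metric.
Proof.
split; [|split].
- apply tabulates_smooth with metric_table;
    [apply orthotoric_domain_open | apply orthotoric_metric_tabulated].
- intros x Hx i j; unfold orthotoric_metric, sq; ring.
- intros x Hx X [i Hi]; rewrite orthotoric_metric_quadratic.
  apply sum_squares_pos.
  + destruct (Hx) as (Hs & Ht & Hth); assert (HQ := Q_pos _ Hs).
    assert (Hsin : 0 < sin (x x_theta)) by (apply sin_gt_0; lra).
    assert (0 < sin (x x_theta) ^ 2) by now apply pow_lt.
    assert (0 < x x_s * x x_t) by nra.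
    intros k _; destruct k; unfold orthotoric_coeff; cbv zeta.
    * apply Rdiv_lt_0_compat; lra.
    * apply Rdiv_neg_neg; nra.
    * nra.
    * apply Rmult_lt_0_compat; nra.
    * apply Rdiv_lt_0_compat; lra.
    * apply Rdiv_neg_neg; nra.
  + destruct (Classical_Prop.classic (exists k, orthotoric_component x X k <> 0))
      as [[k Hk]|N].
    { exists k; split; [apply index_enum_full | trivial]. }
    contradict Hi; apply (orthotoric_component_inj x); trivial.
    intros k; apply Classical_Prop.NNPP; intros Hk; apply N; now exists k.
Qed.

Lemma orthotoric_kahler :
  kahler_with_form orthotoric_domain orthotoric_metric orthotoric_form.
Proof.
apply kahler_tabulated with metric_table form_table complex_table.
- apply orthotoric_domain_open.
- apply orthotoric_riemannian.
- apply orthotoric_metric_tabulated.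
- apply orthotoric_form_tabulated.
- exact complex_defined.
- exact form_closed.
- exact complex_square.
- exact complex_integrable.
- exact complex_hermitian.
- exact complex_form.
Qed.

Lemma orthotoric_ricci_flat : ricci_flat orthotoric_domain orthotoric_metric.
Proof.
exists (fun x k i j => eval (christoffel_table k i j) x); split.
- apply levi_civita_tabulated with metric_table.
  + apply orthotoric_domain_open.
  + apply orthotoric_metric_tabulated.
  + exact christoffel_sym.
  + exact christoffel_metric.
- intros x Hx j k; rewrite ricci_tabulated.
  + now apply christoffel_ricci.
  + intros; now apply christoffel_defined.
Qed.

Lemma orthotoric_metric_invariant : angle_invariant orthotoric_metric.
Proof.
intros x x' _ _ (Es & Et & Eth & _) i j.
unfold orthotoric_metric, fibre_form, eta; now rewrite Es, Et, Eth.
Qed.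

Lemma orthotoric_form_invariant : angle_invariant orthotoric_form.
Proof.
intros x x' _ _ (Es & Et & Eth & _) i j.
unfold orthotoric_form, wedge, E1, E2, E3, E4, E5, E6, fibre_form, eta.
now rewrite Es, Et, Eth.
Qed.

(** * The metric of the exceptional divisor *)

Definition divisor_table : table2 :=
  let t := Var y_t in
  let eta := combine (Cst 1) (coframe y_tau) (Cst 1 - Cos y_theta)%E (coframe y_phi) in
  let c_theta := (Cst (-3) * Inv (Cst 4) * t)%E in
  tensor_sum
  [ (c_theta, coframe y_theta, coframe y_theta);
    (c_theta * Sin y_theta * Sin y_theta, coframe y_phi, coframe y_phi);
    (Cst (-3) * Inv (Cst 4) * (t + Cst 3) * Inv t * Inv (Cst 2 * t + Cst 3),
       coframe y_t, coframe y_t);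
    (c_theta * (Cst 2 * t + Cst 3) * Inv (t + Cst 3), eta, eta) ]%E.

Lemma divisor_domain_open : open_region divisor_domain.
Proof.
intros y ([Ht Ht'] & [Hth Hth']).
repeat apply filter_and; now apply locally_coord_lt || apply locally_coord_gt.
Qed.

Lemma divisor_metric_tabulated :
  tabulates divisor_domain divisor_table divisor_metric.
Proof.
split.
- intros y a b [Ht _]; destruct a, b;
    match goal with |- defined ?e _ => normalize_expr e end;
    cbn [defined eval]; repeat split; lra.
- intros y a b [Ht _]; unfold divisor_metric, divisor_eta, sq, dcoord.
  destruct a, b;
    match goal with |- _ = eval ?e _ => normalize_expr e end;
    cbn [eval index_eq_dec dcoords_index dcoords_rec dcoords_rect];
    field; repeat split; lra.
Qed.

Definition divisor_coeff (y : dcoords -> R) (k : dcoords) : R :=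
  let t := y y_t in
  match k with
  | y_t => - 3 * (t + 3) / (4 * t * (2 * t + 3))
  | y_theta => - (3 * t / 4)
  | y_phi => - (3 * t / 4) * sin (y y_theta) ^ 2
  | y_tau => - 3 * t * (2 * t + 3) / (4 * (t + 3))
  end.

Definition divisor_component (y Y : dcoords -> R) (k : dcoords) : R :=
  match k with
  | y_tau => rsum (fun a => divisor_eta y a * Y a)
  | _ => Y k
  end.

Lemma divisor_metric_quadratic y Y :
  rsum (fun a => rsum (fun b => divisor_metric y a b * Y a * Y b)) =
  rsum (fun k => divisor_coeff y k * divisor_component y Y k ^ 2).
Proof.
unfold divisor_coeff, divisor_metric; cbv zeta; unfold Rdiv.
generalize (/ (4 * y y_t * (2 * y y_t + 3))) (/ (4 * (y y_t + 3))); intros c1 c2.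
unfold divisor_component, divisor_eta, sq, dcoord, rsum; simpl; ring.
Qed.

Lemma divisor_riemannian : riemannian divisor_domain divisor_metric.
Proof.
split; [|split].
- apply tabulates_smooth with divisor_table;
    [apply divisor_domain_open | apply divisor_metric_tabulated].
- intros y Hy a b; unfold divisor_metric, sq; ring.
- intros y [Ht Hth] Y [a Ha]; rewrite divisor_metric_quadratic.
  apply sum_squares_pos.
  + assert (Hsin : 0 < sin (y y_theta)) by (apply sin_gt_0; lra).
    assert (0 < sin (y y_theta) ^ 2) by now apply pow_lt.
    intros k _; destruct k; unfold divisor_coeff; cbv zeta.
    * apply Rdiv_neg_neg; nra.
    * lra.
    * nra.
    * apply Rdiv_lt_0_compat; nra.
  + destruct (Classical_Prop.classic (exists k, divisor_component y Y k <> 0))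
      as [[k Hk]|N].
    { exists k; split; [apply index_enum_full | trivial]. }
    contradict Ha.
    assert (H : forall k, divisor_component y Y k = 0)
      by (intros k; apply Classical_Prop.NNPP; intros Hk; apply N; now exists k).
    assert (H1 := H y_t); assert (H2 := H y_theta); assert (H3 := H y_phi).
    assert (H4 := H y_tau).
    unfold divisor_component, divisor_eta, dcoord, rsum in *; simpl in *.
    rewrite H1, H2, H3 in H4; destruct a; trivial; lra.
Qed.

(** The term in ds^2, singular at s = -3, has no component along a slice of
    constant s; what is left is regular there. *)
Lemma slice_metric s chi y a b :
  orthotoric_metric (slice s chi y) (slice_dir a) (slice_dir b) =
  let t := y y_t in
  1 / 4 * s * t * (sq (dcoord y_theta) a b
                   + sin (y y_theta) ^ 2 * sq (dcoord y_phi) a b)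
  + 3 * (s - t) / (4 * t * (2 * t + 3)) * sq (dcoord y_t) a b
  + (Q s / (t - s) * (t / 2) ^ 2
     + t * (2 * t + 3) / (3 * (s - t)) * (s / 2) ^ 2) * sq (divisor_eta y) a b.
Proof.
unfold orthotoric_metric, fibre_form, eta, divisor_eta, sq, dcoord.
cbv zeta; simpl (slice _ _ _ _).
generalize ((y y_t - s) / (4 * Q s)) (Q s / (y y_t - s)); intros c1 c2.
destruct a, b; simpl; unfold Rdiv; ring.
Qed.

Lemma restriction_to_divisor :
  restricts_to_divisor orthotoric_metric divisor_metric.
Proof.
intros y [Ht _] chi a b.
eapply filterlim_ext; [intros s; symmetry; apply slice_metric|]; cbv zeta.
set (h := fun s : R => _).
replace (divisor_metric y a b) with (h (-3)).
2:{ unfold h, divisor_metric; cbv zeta.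
    rewrite Q_factored by lra; field; lra. }
eapply filterlim_filter_le_1; [apply filter_le_within|].
apply (ex_derive_continuous (V := R_NormedModule) h).
unfold h, Q; auto_derive; repeat split; lra.
Qed.

(** * The potential and the moment relation *)

Definition root (w : R) : R := sqrt (w * (w + 8)).

(** w K'(w), the derivative of the potential with respect to log w. *)
Definition momentum (w : R) : R := 9 / 16 * (root w - w).

Lemma root_pos w : 0 < w -> 0 < root w.
Proof. intros H; apply sqrt_lt_R0; nra. Qed.

Lemma root_sqr w : 0 < w -> root w * root w = w * (w + 8).
Proof. intros H; apply sqrt_sqrt; nra. Qed.

Lemma is_derive_root w : 0 < w -> is_derive root w ((w + 4) / root w).
Proof.
intros H; unfold root; auto_derive; [nra|].
fold (root w); generalize (root_pos w H); intros; field; lra.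
Qed.

(** Since (r - w) (r + w) = 8 w for r = root w, the fraction in the potential is
    1 + (r - w) / 4, and ln (w + r + 4) has derivative 1 / r. *)
Lemma is_derive_potential c w : 0 < w ->
  is_derive (potential c) w (momentum w / w).
Proof.
intros H.
assert (R0 := root_pos w H); assert (R2 := root_sqr w H).
assert (Rd := is_derive_root w H).
apply is_derive_ext_loc with
  (fun v => 9 / 4 * (1 + (root v - v) / 4 + ln (v + root v + 4)) + c).
{ generalize (open_gt 0 w H); apply filter_imp; intros v Hv.
  assert (V0 := root_pos v Hv); assert (V2 := root_sqr v Hv).
  unfold potential; fold (root v); do 3 f_equal.
  apply Rmult_eq_reg_r with (4 * (v + root v)); [|lra].
  field_simplify; [|lra]; nra. }
assert (E : Derive (fun v => root v) w = (w + 4) / root w)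
  by apply is_derive_unique, Rd.
auto_derive.
- repeat split; try lra; now exists ((w + 4) / root w).
- rewrite E; unfold momentum; field [R2]; repeat split; lra.
Qed.

Lemma is_derive_momentum w : 0 < w ->
  is_derive momentum w (9 / 16 * ((w + 4) / root w - 1)).
Proof.
intros H; unfold momentum; assert (Rd := is_derive_root w H).
auto_derive; [now exists ((w + 4) / root w)|].
replace (Derive (fun x => root x) w) with ((w + 4) / root w)
  by (symmetry; apply is_derive_unique, Rd).
ring.
Qed.

(** The solution varpi of the moment relation. *)
Definition varpi_of_t (t : R) : R := 8 * t ^ 2 / (3 * (2 * t + 3)).

Lemma varpi_of_t_pos t : - (3 / 2) < t < 0 -> 0 < varpi_of_t t.
Proof. intros H; unfold varpi_of_t; apply Rdiv_lt_0_compat; nra. Qed.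

Lemma root_varpi_of_t t : - (3 / 2) < t < 0 ->
  root (varpi_of_t t) = - (8 * t * (t + 3)) / (3 * (2 * t + 3)).
Proof.
intros H; unfold root; apply sqrt_lem_1.
- generalize (varpi_of_t_pos t H); nra.
- apply Rlt_le, Rdiv_lt_0_compat; nra.
- unfold varpi_of_t; field; lra.
Qed.

(** The relation reads root w = w - (8/3) t, and squaring it cancels w^2. *)
Lemma moment_relation_iff c t w : - (3 / 2) < t < 0 -> 0 < w ->
  (moment_relation c t w <-> w = varpi_of_t t).
Proof.
intros Ht Hw; unfold moment_relation.
replace (- (2 / 3) * w * Derive (potential c) w) with (- (3 / 8) * (root w - w)).
2:{ replace (Derive (potential c) w) with (momentum w / w)
      by (symmetry; now apply is_derive_unique, is_derive_potential).
    unfold momentum; field; lra. }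
split; intros E.
- assert (R2 := root_sqr w Hw).
  replace (root w) with (w - 8 / 3 * t) in R2 by lra.
  unfold varpi_of_t; apply Rmult_eq_reg_r with (3 * (2 * t + 3)); [|lra].
  field_simplify; [|lra]; nra.
- rewrite E, root_varpi_of_t by trivial; unfold varpi_of_t; field; lra.
Qed.

(** The inverse t = - (3/8) (root w - w) of [varpi_of_t] takes values in the domain,
    because w < root w < w + 4. *)
Lemma moment_relation_range w : 0 < w -> - (3 / 2) < - (3 / 8) * (root w - w) < 0.
Proof.
intros H; assert (R0 := root_pos w H); assert (R2 := root_sqr w H).
split; nra.
Qed.

Lemma momentum_varpi_of_t t : - (3 / 2) < t < 0 -> momentum (varpi_of_t t) = - (3 / 2) * t.
Proof.
intros H; unfold momentum; rewrite root_varpi_of_t by trivial.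
unfold varpi_of_t; field; lra.
Qed.

(** K_xx for x = log varpi, expressed by t. *)
Lemma dmomentum_varpi_of_t t : - (3 / 2) < t < 0 ->
  varpi_of_t t * (9 / 16 * ((varpi_of_t t + 4) / root (varpi_of_t t) - 1))
  = - (3 / 4) * t * (2 * t + 3) / (t + 3).
Proof.
intros H; rewrite root_varpi_of_t by trivial.
unfold varpi_of_t; field; repeat split; lra.
Qed.

(** * The metric of the potential *)

Definition fibre_norm (z : holo -> C) : R := 1 + fst (z z_u) ^ 2 + snd (z z_u) ^ 2.

Lemma Cmod_sqr (z : C) : Cmod z ^ 2 = fst z ^ 2 + snd z ^ 2.
Proof. unfold Cmod; rewrite <- Rsqr_pow2, Rsqr_sqrt; trivial; nra. Qed.

Lemma C_neq_0 (z : C) : z <> RtoC 0 <-> 0 < fst z ^ 2 + snd z ^ 2.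
Proof.
destruct z as [a b]; simpl; split.
- intros H; destruct (Req_dec a 0) as [->|]; [|nra].
  destruct (Req_dec b 0) as [->|]; [now contradict H|nra].
- intros H E; injection E as -> ->; lra.
Qed.

Lemma varpi_eq z : varpi z = fibre_norm z ^ 2 * (fst (z z_v) ^ 2 + snd (z z_v) ^ 2).
Proof. unfold varpi, fibre_norm; rewrite !Cmod_sqr; ring. Qed.

Lemma varpi_pos z : z z_v <> RtoC 0 -> 0 < varpi z.
Proof.
rewrite C_neq_0, varpi_eq; intros H; apply Rmult_lt_0_compat; trivial.
unfold fibre_norm; nra.
Qed.

(** The coefficients of the (1,0)-form d' log varpi:
    2 conj(u) / (1 + |u|^2) for du and 1 / v for dv. *)
Definition dlog (j : holo) (z : holo -> C) : C :=
  match j with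
  | z_u => (2 * fst (z z_u) / fibre_norm z, - (2 * snd (z z_u)) / fibre_norm z)
  | z_v => (fst (z z_v) / (fst (z z_v) ^ 2 + snd (z z_v) ^ 2),
            - snd (z z_v) / (fst (z z_v) ^ 2 + snd (z z_v) ^ 2))
  end.

Definition shift (z : holo -> C) (j : holo) (w : C) (a : R) : holo -> C :=
  update z j (z j + RtoC a * w)%C.

(** d (log varpi) = 2 Re (d' log varpi). *)
Lemma is_derive_varpi z j w : z z_v <> RtoC 0 ->
  is_derive (fun a => varpi (shift z j w a)) 0 (2 * varpi z * fst (dlog j z * w)%C).
Proof.
intros H; apply C_neq_0 in H.
apply is_derive_ext with (fun a => fibre_norm (shift z j w a) ^ 2 *
  (fst (shift z j w a z_v) ^ 2 + snd (shift z j w a z_v) ^ 2));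
  [intros a; now rewrite varpi_eq|].
rewrite varpi_eq.
assert (N0 : fibre_norm z <> 0) by (unfold fibre_norm; nra).
destruct j; unfold dlog, fibre_norm, shift, update in *; simpl in *;
  auto_derive; trivial; field; nra.
Qed.

Lemma shift_0 z j w : shift z j w 0 = z.
Proof.
apply functional_extensionality; intros k; unfold shift, update.
destruct (index_eq_dec j k) as [<-|]; trivial.
apply injective_projections; simpl; ring.
Qed.

Lemma shift_off_axis z j w : z z_v <> RtoC 0 ->
  locally 0 (fun a => shift z j w a z_v <> RtoC 0).
Proof.
intros H; apply C_neq_0 in H.
assert (K : continuous (fun a =>
  fst (shift z j w a z_v) ^ 2 + snd (shift z j w a z_v) ^ 2) 0).
{ apply (ex_derive_continuous (V := R_NormedModule));
    destruct j; unfold shift, update; simpl;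
    auto_derive; trivial. }
rewrite <- (shift_0 z j w) in H.
assert (L := K _ (open_gt 0 _ H)); unfold filtermap in L.
revert L; apply filter_imp; intros a; apply C_neq_0.
Qed.

Lemma line_derivative_shift j w F z (f1 f2 : R) :
  is_derive (fun a => fst (F (shift z j w a))) 0 f1 ->
  is_derive (fun a => snd (F (shift z j w a))) 0 f2 ->
  line_derivative j w F z = (f1, f2).
Proof.
intros H1 H2; unfold line_derivative; f_equal; now apply is_derive_unique.
Qed.

Lemma line_derivative_radial (h : R -> R) h' j w z : z z_v <> RtoC 0 ->
  is_derive h (varpi z) h' ->
  is_derive (fun a => h (varpi (shift z j w a))) 0
    (2 * varpi z * h' * fst (dlog j z * w)%C).
Proof.
intros Hz Hh.
replace (2 * varpi z * h' * fst (dlog j z * w)%C)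
  with (scal (2 * varpi z * fst (dlog j z * w)%C) h').
2:{ unfold scal; simpl; unfold mult; simpl; ring. }
apply (is_derive_comp h (fun a => varpi (shift z j w a))).
- now rewrite shift_0.
- now apply is_derive_varpi.
Qed.

Lemma dzbar_potential c j z : z z_v <> RtoC 0 ->
  dzbar j (fun z' => RtoC (potential c (varpi z'))) z
  = (RtoC (momentum (varpi z)) * Cconj (dlog j z))%C.
Proof.
intros Hz; assert (Hw := varpi_pos z Hz).
assert (L : forall w, line_derivative j w (fun z' => RtoC (potential c (varpi z'))) z
                      = (2 * momentum (varpi z) * fst (dlog j z * w)%C, 0)).
{ intros w; apply line_derivative_shift; simpl; [|apply @is_derive_const].
  replace (2 * momentum (varpi z)) with (2 * varpi z * (momentum (varpi z) / varpi z))
    by (field; lra).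
  apply (line_derivative_radial (potential c)); trivial.
  now apply is_derive_potential. }
unfold dzbar; rewrite !L; apply injective_projections; simpl; field.
Qed.

(** The coefficients of the mixed Hessian of log varpi. *)
Definition log_hessian (i j : holo) (z : holo -> C) : R :=
  match i, j with z_u, z_u => 2 / fibre_norm z ^ 2 | _, _ => 0 end.

(** The derivative of conj (dlog j) in the direction w of the coordinate z^i: up to
    a constant factor dlog j is the conjugate of p / m with m quadratic in p, for
    which [slope] is the quotient rule. *)
Definition dlog_bar_line (i j : holo) (w : C) (z : holo -> C) : C :=
  let slope (p : C) (m : R) : C :=
    (fst w / m - 2 * fst p * (fst p * fst w + snd p * snd w) / m ^ 2,
     snd w / m - 2 * snd p * (fst p * fst w + snd p * snd w) / m ^ 2) in
  match i, j with
  | z_u, z_u => (RtoC 2 * slope (z z_u) (fibre_norm z))%C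
  | z_v, z_v => slope (z z_v) (fst (z z_v) ^ 2 + snd (z z_v) ^ 2)
  | _, _ => RtoC 0
  end.

Lemma is_derive_dlog_bar i j w z : z z_v <> RtoC 0 ->
  is_derive (fun a => fst (Cconj (dlog j (shift z i w a)))) 0 (fst (dlog_bar_line i j w z)) /\
  is_derive (fun a => snd (Cconj (dlog j (shift z i w a)))) 0 (snd (dlog_bar_line i j w z)).
Proof.
intros H; apply C_neq_0 in H.
assert (N0 : fibre_norm z <> 0) by (unfold fibre_norm; nra).
destruct i, j; unfold dlog_bar_line, dlog, fibre_norm, shift, update in *; simpl in *;
 split; auto_derive; trivial; try (repeat split; nra); field; nra.
Qed.

(** For x = log varpi the antiholomorphic derivative of the potential is K_x d''x;
    differentiating K_x gives the first term, differentiating d''x the second. *)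
Lemma kronheimer_metric_eq c z i j : z z_v <> RtoC 0 ->
  kronheimer_metric c z i j =
  (RtoC (varpi z * (9 / 16 * ((varpi z + 4) / root (varpi z) - 1)))
     * (dlog i z * Cconj (dlog j z))
   + RtoC (momentum (varpi z) * log_hessian i j z))%C.
Proof.
intros Hz; assert (Hw := varpi_pos z Hz).
set (h' := 9 / 16 * ((varpi z + 4) / root (varpi z) - 1)).
assert (Hh : is_derive momentum (varpi z) h') by now apply is_derive_momentum.
assert (L : forall w,
  line_derivative i w (dzbar j (fun z' => RtoC (potential c (varpi z')))) z
  = (RtoC (2 * varpi z * h' * fst (dlog i z * w)%C) * Cconj (dlog j z)
     + RtoC (momentum (varpi z)) * dlog_bar_line i j w z)%C).
{ intros w; destruct (is_derive_dlog_bar i j w z Hz) as [D1 D2].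
  assert (Dh := line_derivative_radial momentum h' i w z Hz Hh).
  assert (E := shift_off_axis z i w Hz).
  assert (Pr : forall (p : R -> R) (p0 p' : R), p 0 = p0 -> is_derive p 0 p' ->
    is_derive (fun a => momentum (varpi (shift z i w a)) * p a) 0
      (2 * varpi z * h' * fst (dlog i z * w)%C * p0 + momentum (varpi z) * p')).
  { intros p p0 p' <- Hp.
    replace (momentum (varpi z)) with (momentum (varpi (shift z i w 0)))
      by now rewrite shift_0.
    apply (is_derive_mult (fun a => momentum (varpi (shift z i w a))) p); trivial.
    intros; apply Rmult_comm. }
  transitivity
    (2 * varpi z * h' * fst (dlog i z * w)%C * fst (Cconj (dlog j z))
       + momentum (varpi z) * fst (dlog_bar_line i j w z),
     2 * varpi z * h' * fst (dlog i z * w)%C * snd (Cconj (dlog j z))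
       + momentum (varpi z) * snd (dlog_bar_line i j w z)).
  2:{ apply injective_projections; simpl; ring. }
  apply line_derivative_shift.
  - apply is_derive_ext_loc with
      (fun a => momentum (varpi (shift z i w a)) * fst (Cconj (dlog j (shift z i w a)))).
    + revert E; apply filter_imp; intros a Ha; rewrite dzbar_potential by trivial.
      simpl; ring.
    + apply (Pr (fun a => fst (Cconj (dlog j (shift z i w a))))); trivial; now rewrite shift_0.
  - apply is_derive_ext_loc with
      (fun a => momentum (varpi (shift z i w a)) * snd (Cconj (dlog j (shift z i w a)))).
    + revert E; apply filter_imp; intros a Ha; rewrite dzbar_potential by trivial.
      simpl; ring.
    + apply (Pr (fun a => snd (Cconj (dlog j (shift z i w a))))); trivial; now rewrite shift_0. }
unfold kronheimer_metric, metric_of_potential, dz; rewrite !L.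
apply C_neq_0 in Hz; clear L Hh.
clearbody h'; generalize (momentum (varpi z)); generalize (varpi z); intros w m.
assert (N0 : fibre_norm z <> 0) by (unfold fibre_norm; nra).
destruct i, j; unfold dlog_bar_line, dlog; simpl; apply injective_projections; simpl;
  try (field; nra); unfold fibre_norm in *; field; nra.
Qed.

(** * The chart identifying the two coordinate systems *)

(** |v|, determined by varpi = (1 + |u|^2)^2 |v|^2. *)
Definition modulus (y : dcoords -> R) : R :=
  sqrt (varpi_of_t (y y_t)) / (1 + tan (y y_theta / 2) ^ 2).

Definition chart (y : dcoords -> R) : holo -> C := fun k =>
  match k with
  | z_u => (RtoC (tan (y y_theta / 2)) * cis (y y_phi))%C
  | z_v => (RtoC (modulus y) * cis (y y_tau))%C
  end.

Lemma half_angle th : 0 < th < PI -> 0 < cos (th / 2) /\ 0 < sin (th / 2) /\ 0 < tan (th / 2).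
Proof.
intros H.
assert (0 < cos (th / 2)) by (apply cos_gt_0; lra).
assert (0 < sin (th / 2)) by (apply sin_gt_0; lra).
repeat split; trivial; now apply Rdiv_lt_0_compat.
Qed.

Lemma modulus_pos y : divisor_domain y -> 0 < modulus y.
Proof.
intros [Ht Hth]; apply Rdiv_lt_0_compat; [|generalize (pow2_ge_0 (tan (y y_theta / 2))); lra].
now apply sqrt_lt_R0, varpi_of_t_pos.
Qed.

Lemma Cmod_polar m a : 0 <= m -> Cmod (RtoC m * cis a)%C = m.
Proof.
intros H; apply Rsqr_inj; [apply Cmod_ge_0|trivial|].
rewrite !Rsqr_pow2, Cmod_sqr; simpl.
generalize (sin2_cos2 a); unfold Rsqr; intros E.
transitivity (m * m * (sin a * sin a + cos a * cos a)); [ring|rewrite E; ring].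
Qed.

Lemma cis_eq a b : cis a = cis b <-> angle_eq (2 * PI) a b.
Proof.
split.
- intros E; injection E as Ec Es.
  assert (C1 : cos (2 * ((a - b) / 2)) = 1).
  { replace (2 * ((a - b) / 2)) with (a - b) by field.
    rewrite cos_minus, Ec, Es; generalize (sin2_cos2 b); unfold Rsqr; lra. }
  rewrite cos_2a_sin in C1.
  destruct (sin_eq_0_0 ((a - b) / 2)) as [k Hk]; [nra|].
  exists k; lra.
- intros [k Hk]; replace a with (b + 2 * (PI * IZR k)) by lra.
  assert (S : sin (PI * IZR k) = 0).
  { apply sin_eq_0_1; exists k; ring. }
  assert (Cc := sin2_cos2 (PI * IZR k)); unfold Rsqr in Cc.
  unfold cis; rewrite cos_plus, sin_plus, sin_2a, cos_2a, S.
  rewrite S in Cc.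
  replace (cos (PI * IZR k) * cos (PI * IZR k) - 0 * 0) with 1 by lra.
  f_equal; ring.
Qed.

Lemma polar_form (z : C) : exists a, z = (RtoC (Cmod z) * cis a)%C.
Proof.
destruct (Ceq_dec z (RtoC 0)) as [->|Hz].
{ exists 0; rewrite Cmod_0; apply injective_projections; simpl; ring. }
apply C_neq_0 in Hz; assert (M := Cmod_sqr z); assert (M0 := Cmod_ge_0 z).
assert (Mp : 0 < Cmod z) by nra.
set (p := fst z / Cmod z); set (m := snd z / Cmod z).
assert (E : p ^ 2 + m ^ 2 = 1).
{ unfold p, m; field_simplify; [|lra]; rewrite <- M; field; lra. }
assert (Hp : -1 <= p <= 1) by nra.
assert (Ha : exists a, cos a = p /\ sin a = m).
{ destruct (Rle_dec 0 m).
  - exists (acos p); rewrite cos_acos, sin_acos by trivial; split; trivial.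
    apply sqrt_lem_1; unfold Rsqr; nra.
  - exists (- acos p); rewrite cos_neg, sin_neg, cos_acos, sin_acos by trivial; split; trivial.
    enough (sqrt (1 - p²) = - m) by lra.
    apply sqrt_lem_1; unfold Rsqr; nra. }
destruct Ha as [a [Ec Es]]; exists a; unfold cis; rewrite Ec, Es; unfold p, m.
apply injective_projections; simpl; field; lra.
Qed.

Lemma polar_inj m m' a a' : 0 < m -> 0 < m' ->
  (RtoC m * cis a)%C = (RtoC m' * cis a')%C <-> m = m' /\ angle_eq (2 * PI) a a'.
Proof.
intros Hm Hm'; split.
- intros E; assert (Em : m = m').
  { rewrite <- (Cmod_polar m a), <- (Cmod_polar m' a') by lra; now rewrite E. }
  split; trivial; subst m'; apply cis_eq.
  unfold cis in *; injection E as E1 E2; f_equal; nra.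
- intros [-> E]; apply cis_eq in E; now rewrite E.
Qed.

Lemma tan_half_inj a b : 0 < a < PI -> 0 < b < PI -> tan (a / 2) = tan (b / 2) -> a = b.
Proof.
intros Ha Hb E; apply tan_inj in E; lra.
Qed.

Lemma varpi_of_t_inj t t' : - (3 / 2) < t < 0 -> - (3 / 2) < t' < 0 ->
  varpi_of_t t = varpi_of_t t' -> t = t'.
Proof.
intros H H' E; assert (M := momentum_varpi_of_t t H).
rewrite E, momentum_varpi_of_t in M by trivial.
lra.
Qed.

Lemma varpi_chart y : divisor_domain y -> varpi (chart y) = varpi_of_t (y y_t).
Proof.
intros H; assert (P0 := modulus_pos y H); destruct H as [Ht Hth].
unfold varpi; simpl chart; rewrite !Cmod_polar by
  (apply Rlt_le; trivial; now apply half_angle).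
unfold modulus, Rdiv; rewrite Rpow_mult_distr, <- Rsqr_pow2 with (x := sqrt _).
rewrite Rsqr_sqrt by now apply Rlt_le, varpi_of_t_pos.
field; nra.
Qed.

Lemma chart_v_neq_0 y : divisor_domain y -> chart y z_v <> RtoC 0.
Proof.
intros H E; apply (f_equal Cmod) in E; simpl in E.
rewrite Cmod_0, Cmod_polar in E; generalize (modulus_pos y H); lra.
Qed.

Lemma identified_chart c y z : divisor_domain y ->
  (identified c y z <-> forall k, z k = chart y k).
Proof.
intros H; assert (P0 := modulus_pos y H); assert (V := varpi_chart y H).
destruct (H) as [Ht Hth].
assert (T0 : 0 <= tan (y y_theta / 2)) by (apply Rlt_le; now apply half_angle).
split.
- intros (Hu & Hv & Hv' & Hm).
  apply moment_relation_iff in Hm; [|trivial|now apply varpi_pos].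
  intros []; simpl; trivial.
  rewrite Hv'; do 2 f_equal.
  unfold varpi in Hm; rewrite Hu, Cmod_polar in Hm by trivial.
  unfold modulus; rewrite <- Hm, sqrt_mult_alt by (apply pow2_ge_0).
  rewrite !sqrt_pow2 by (apply Cmod_ge_0 || nra); field; nra.
- intros E.
  assert (Ez : z = chart y) by now apply functional_extensionality.
  rewrite Ez; repeat split.
  + now apply chart_v_neq_0.
  + simpl; now rewrite Cmod_polar by lra.
  + apply moment_relation_iff; trivial; now apply varpi_pos, chart_v_neq_0.
Qed.

Lemma chart_inj y y' : divisor_domain y -> divisor_domain y' ->
  ((forall k, chart y k = chart y' k) <-> same_divisor_point y y').
Proof.
intros H H'; assert (M := modulus_pos y H); assert (M' := modulus_pos y' H').
assert (V := varpi_chart y H); assert (V' := varpi_chart y' H').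
destruct H as [Ht Hth], H' as [Ht' Hth'].
assert (T := proj2 (proj2 (half_angle _ Hth))).
assert (T' := proj2 (proj2 (half_angle _ Hth'))).
unfold same_divisor_point; split.
- intros E.
  assert (Eu := E z_u); assert (Ev := E z_v); simpl in Eu, Ev.
  apply polar_inj in Eu; trivial; apply polar_inj in Ev; trivial.
  assert (Ez : chart y = chart y') by now apply functional_extensionality.
  rewrite Ez, V' in V.
  repeat split; try tauto.
  + now apply varpi_of_t_inj.
  + now apply tan_half_inj.
- intros (Et & Eth & Ep & Eta) k; destruct k; simpl; apply polar_inj; trivial.
  + now rewrite Eth.
  + unfold modulus; now rewrite Et, Eth.
Qed.

Lemma chart_onto z : z z_u <> RtoC 0 -> z z_v <> RtoC 0 ->
  exists y, divisor_domain y /\ forall k, chart y k = z k.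
Proof.
intros Hu Hv; assert (Hw := varpi_pos z Hv).
destruct (polar_form (z z_u)) as [a Ha], (polar_form (z z_v)) as [b Hb].
apply Cmod_gt_0 in Hu.
set (t := - (3 / 8) * (root (varpi z) - varpi z)).
set (y := fun k => match k with
  | y_t => t | y_theta => 2 * atan (Cmod (z z_u)) | y_phi => a | y_tau => b end).
assert (Hy : divisor_domain y).
{ split; [now apply moment_relation_range|]; simpl.
  assert (A := atan_bound (Cmod (z z_u))); assert (A0 := atan_increasing _ _ Hu).
  rewrite atan_0 in A0; lra. }
exists y; split; trivial.
intros k; symmetry; revert k; apply (identified_chart 0); trivial.
repeat split; trivial; simpl.
- replace (2 * atan (Cmod (z z_u)) / 2) with (atan (Cmod (z z_u))) by field.
  now rewrite tan_atan.
- unfold moment_relation.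
  replace (Derive (potential 0) (varpi z)) with (momentum (varpi z) / varpi z)
      by (symmetry; now apply is_derive_unique, is_derive_potential).
  unfold t, momentum; field; lra.
Qed.

(** * The pulled-back metric *)

Definition dchart (k : holo) (a : dcoords) (y : dcoords -> R) : C :=
  let T := tan (y y_theta / 2) in let t := y y_t in
  match k, a with
  | z_u, y_theta => (RtoC ((1 + T ^ 2) / 2) * cis (y y_phi))%C
  | z_u, y_phi => (Ci * chart y z_u)%C
  | z_v, y_t => (RtoC ((t + 3) / (t * (2 * t + 3))) * chart y z_v)%C
  | z_v, y_theta => (RtoC (- T) * chart y z_v)%C
  | z_v, y_tau => (Ci * chart y z_v)%C
  | _, _ => RtoC 0
  end.

Lemma is_derive_half_tan th : 0 < th < PI ->
  is_derive (fun a => tan (a / 2)) th ((1 + tan (th / 2) ^ 2) / 2).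
Proof.
intros H; destruct (half_angle th H) as (C0 & _).
unfold tan; auto_derive; change (th * / 2) with (th / 2); [lra|field; lra].
Qed.

Lemma is_derive_sqrt_varpi_of_t t : - (3 / 2) < t < 0 ->
  is_derive (fun a => sqrt (varpi_of_t a)) t ((t + 3) / (t * (2 * t + 3)) * sqrt (varpi_of_t t)).
Proof.
intros H; assert (W := varpi_of_t_pos t H); assert (W0 := sqrt_lt_R0 _ W).
assert (D : is_derive varpi_of_t t (2 * ((t + 3) / (t * (2 * t + 3))) * varpi_of_t t)).
{ unfold varpi_of_t; auto_derive; [lra|field; lra]. }
assert (E : Derive (fun x => varpi_of_t x) t = 2 * ((t + 3) / (t * (2 * t + 3))) * varpi_of_t t)
  by apply is_derive_unique, D.
auto_derive; [repeat split; trivial;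
  now exists (2 * ((t + 3) / (t * (2 * t + 3))) * varpi_of_t t)|].
rewrite E; rewrite <- (sqrt_sqrt (varpi_of_t t)) at 1 by lra; field; lra.
Qed.

Lemma is_derive_modulus y a : divisor_domain y ->
  is_derive (fun r => modulus (update y a r)) (y a)
    (match a with
     | y_t => (y y_t + 3) / (y y_t * (2 * y y_t + 3))
     | y_theta => - tan (y y_theta / 2)
     | _ => 0
     end * modulus y).
Proof.
intros [Ht Hth].
assert (N := pow2_ge_0 (tan (y y_theta / 2))).
destruct a; unfold modulus, update; simpl index_eq_dec; cbv iota.
- evar_last.
  + apply (is_derive_scal_l (V := R_NormedModule)), is_derive_sqrt_varpi_of_t, Ht.
  + unfold scal; simpl; unfold mult; simpl; field; split; nra.
- assert (D := is_derive_half_tan _ Hth); set (T := fun a => tan (a / 2)) in D.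
  change (is_derive (fun r => sqrt (varpi_of_t (y y_t)) / (1 + T r ^ 2)) (y y_theta)
     (- T (y y_theta) * (sqrt (varpi_of_t (y y_t)) / (1 + T (y y_theta) ^ 2)))).
  change (is_derive T (y y_theta) ((1 + T (y y_theta) ^ 2) / 2)) in D.
  assert (E : Derive (fun x => T x) (y y_theta) = (1 + T (y y_theta) ^ 2) / 2)
    by apply is_derive_unique, D.
  change (0 <= T (y y_theta) ^ 2) in N.
  clearbody T; auto_derive.
  + repeat split; [now exists ((1 + T (y y_theta) ^ 2) / 2) | nra].
  + rewrite E; field; nra.
- rewrite Rmult_0_l; apply @is_derive_const.
- rewrite Rmult_0_l; apply @is_derive_const.
Qed.

Lemma derive_polar (m p : R -> R) x m' p' : is_derive m x m' -> is_derive p x p' ->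
  (Derive (fun a => fst (RtoC (m a) * cis (p a))%C) x,
   Derive (fun a => snd (RtoC (m a) * cis (p a))%C) x)
  = (RtoC m' * cis (p x) + RtoC p' * (Ci * (RtoC (m x) * cis (p x))))%C.
Proof.
intros Hm Hp.
assert (Em : Derive (fun x => m x) x = m') by apply is_derive_unique, Hm.
assert (Ep : Derive (fun x => p x) x = p') by apply is_derive_unique, Hp.
assert (ex_derive (fun x => m x) x) by now exists m'.
assert (ex_derive (fun x => p x) x) by now exists p'.
apply injective_projections; apply is_derive_unique; simpl; auto_derive; auto;
  rewrite Em, Ep; ring.
Qed.

Lemma partial_chart k a y : divisor_domain y ->
  (partial a (fun y' => fst (chart y' k)) y, partial a (fun y' => snd (chart y' k)) y)
  = dchart k a y.
Proof.
intros H; destruct (H) as [Ht Hth]; unfold partial.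
assert (Hp : forall b,
  is_derive (fun r => update y a r b) (y a) (if index_eq_dec a b then 1 else 0))
  by (intros b; apply is_derive_coord).
assert (Id : forall b, update y a (y a) b = y b).
{ intros b; unfold update; destruct (index_eq_dec a b) as [<-|]; trivial. }
assert (Idf : update y a (y a) = y) by now apply functional_extensionality.
destruct k; unfold chart.
- rewrite (derive_polar (fun r => tan (update y a r y_theta / 2)) (fun r => update y a r y_phi)
    (y a) (match a with y_theta => (1 + tan (y y_theta / 2) ^ 2) / 2 | _ => 0 end)
    (if index_eq_dec a y_phi then 1 else 0)); [| | apply Hp].
  + rewrite !Id; destruct a; apply injective_projections; simpl; ring.
  + destruct a; unfold update; simpl; try apply @is_derive_const.
    now apply is_derive_half_tan.
- rewrite (derive_polar _ _ (y a) _ _ (is_derive_modulus y a H) (Hp y_tau)).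
  rewrite Id, Idf; destruct a; apply injective_projections; simpl; ring.
Qed.

Lemma half_angle_tan th : 0 < th < PI ->
  cos th = (1 - tan (th / 2) ^ 2) / (1 + tan (th / 2) ^ 2) /\
  sin th = 2 * tan (th / 2) / (1 + tan (th / 2) ^ 2).
Proof.
intros H; destruct (half_angle th H) as (C0 & _).
assert (E := sin2_cos2 (th / 2)); unfold Rsqr in E.
assert (Ec := cos_2a (th / 2)); assert (Es := sin_2a (th / 2)).
replace (2 * (th / 2)) with th in Ec, Es by field; rewrite Ec, Es; unfold tan.
assert (E' : 1 + (sin (th / 2) / cos (th / 2)) ^ 2 = 1 / (cos (th / 2) * cos (th / 2))).
{ assert (E' : sin (th / 2) * sin (th / 2) = 1 - cos (th / 2) * cos (th / 2)) by lra.
  field [E']; lra. }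
rewrite E'; split; field; lra.
Qed.

Lemma fibre_norm_chart y : fibre_norm (chart y) = 1 + tan (y y_theta / 2) ^ 2.
Proof.
assert (Ep := sin2_cos2 (y y_phi)); unfold Rsqr in Ep.
unfold fibre_norm; simpl.
transitivity (1 + tan (y y_theta / 2) ^ 2
    * (sin (y y_phi) * sin (y y_phi) + cos (y y_phi) * cos (y y_phi)));
    [ring|rewrite Ep; ring].
Qed.

Lemma csum_holo (F : holo -> C) : csum F = (F z_u + F z_v)%C.
Proof. unfold csum; simpl; ring. Qed.

(** d' log varpi = d (log varpi) / 2 + i eta: the theta components of du and dv
    cancel, and the angles contribute dtau + 2 T^2 / (1 + T^2) dphi with
    T = tan (theta / 2). *)
Lemma dlog_chart y a : divisor_domain y ->
  (dlog z_u (chart y) * dchart z_u a y + dlog z_v (chart y) * dchart z_v a y)%C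
   = ((y y_t + 3) / (y y_t * (2 * y y_t + 3)) * dcoord y_t a, divisor_eta y a).
Proof.
intros H; assert (M := modulus_pos y H).
destruct H as [Ht Hth]; destruct (half_angle_tan _ Hth) as [Ec _].
assert (Ep := sin2_cos2 (y y_phi)); assert (Et := sin2_cos2 (y y_tau)); unfold Rsqr in Ep, Et.
assert (N' : fst (chart y z_v) ^ 2 + snd (chart y z_v) ^ 2 = modulus y ^ 2).
{ simpl.
  transitivity (modulus y ^ 2
    * (sin (y y_tau) * sin (y y_tau) + cos (y y_tau) * cos (y y_tau)));
    [ring|rewrite Et; ring]. }
unfold dlog, divisor_eta; rewrite fibre_norm_chart, N', Ec.
assert (T2 := pow2_ge_0 (tan (y y_theta / 2))).
assert (Ep' : sin (y y_phi) * sin (y y_phi) = 1 - cos (y y_phi) * cos (y y_phi)) by lra.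
assert (Et' : sin (y y_tau) * sin (y y_tau) = 1 - cos (y y_tau) * cos (y y_tau)) by lra.
clear Ec N' Ep Et.
unfold dchart, chart.
generalize dependent (tan (y y_theta / 2)); generalize dependent (modulus y).
intros m Hm T HT.
destruct a; unfold cis, dcoord; simpl; apply injective_projections; simpl;
  field [Ep' Et']; repeat split; lra || nra.
Qed.

(** |du|^2 / (1 + |u|^2)^2 is a quarter of the round metric of the sphere. *)
Lemma du_chart y a b : divisor_domain y ->
  (dchart z_u a y * Cconj (dchart z_u b y) + dchart z_u b y * Cconj (dchart z_u a y))%C
  = RtoC ((1 + tan (y y_theta / 2) ^ 2) ^ 2 / 2 *
     (dcoord y_theta a * dcoord y_theta b
      + sin (y y_theta) ^ 2 * dcoord y_phi a * dcoord y_phi b)).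
Proof.
intros [Ht Hth]; destruct (half_angle_tan _ Hth) as [_ ->].
assert (Ep := sin2_cos2 (y y_phi)); unfold Rsqr in Ep.
assert (Ep' : sin (y y_phi) * sin (y y_phi) = 1 - cos (y y_phi) * cos (y y_phi)) by lra.
assert (T2 := pow2_ge_0 (tan (y y_theta / 2))); clear Ep.
unfold dchart, chart; generalize dependent (tan (y y_theta / 2)).
intros T HT.
destruct a, b; unfold cis, dcoord; simpl; apply injective_projections; simpl;
 field [Ep']; nra.
Qed.

Lemma pullback_kronheimer c y a b : divisor_domain y ->
  pullback_hermitian chart (kronheimer_metric c) y a b = RtoC (divisor_metric y a b).
Proof.
intros H; assert (W := varpi_chart y H); assert (V := chart_v_neq_0 y H).
destruct (H) as [Ht _].
assert (T2 := pow2_ge_0 (tan (y y_theta / 2))).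
unfold pullback_hermitian; rewrite !csum_holo; cbv beta zeta.
rewrite !kronheimer_metric_eq, W, momentum_varpi_of_t, dmomentum_varpi_of_t by trivial.
rewrite !partial_chart by trivial.
simpl log_hessian; rewrite fibre_norm_chart.
set (k := - (3 / 4) * y y_t * (2 * y y_t + 3) / (y y_t + 3)).
(* The first bracket is twice the symmetric product of the form of [dlog_chart]. *)
transitivity (RtoC (k / 2) *
  ((dlog z_u (chart y) * dchart z_u a y + dlog z_v (chart y) * dchart z_v a y)
     * Cconj (dlog z_u (chart y) * dchart z_u b y + dlog z_v (chart y) * dchart z_v b y)
 + (dlog z_u (chart y) * dchart z_u b y + dlog z_v (chart y) * dchart z_v b y)
     * Cconj (dlog z_u (chart y) * dchart z_u a y + dlog z_v (chart y) * dchart z_v a y))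
 + RtoC (- (3 / 2) * y y_t / (1 + tan (y y_theta / 2) ^ 2) ^ 2) *
   (dchart z_u a y * Cconj (dchart z_u b y) + dchart z_u b y * Cconj (dchart z_u a y)))%C.
{ clear - T2.
  generalize (dchart z_u a y) (dchart z_u b y) (dchart z_v a y) (dchart z_v b y)
    (dlog z_u (chart y)) (dlog z_v (chart y)).
  generalize dependent (tan (y y_theta / 2)).
  intros T HT u1 u2 v1 v2 lu lv.
  apply injective_projections; simpl; field; simpl in HT; lra. }
rewrite !dlog_chart, du_chart by trivial.
unfold divisor_metric, sq, k; generalize dependent (tan (y y_theta / 2)); intros.
apply injective_projections; simpl; field; simpl in *; repeat split; lra.
Qed.

(** * The theorem *)

Theorem mainTheorem2 :
  (* (1) *)
  (angle_invariant orthotoric_metric /\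
   angle_invariant orthotoric_form /\
   kahler_with_form orthotoric_domain orthotoric_metric orthotoric_form /\
   ricci_flat orthotoric_domain orthotoric_metric) /\
  (* (2) *)
  (riemannian divisor_domain divisor_metric /\
   restricts_to_divisor orthotoric_metric divisor_metric /\
   forall c : R,
     (forall t w : R, -(3/2) < t < 0 -> 0 < w ->
        (moment_relation c t w <-> w = 8 * t ^ 2 / (3 * (2 * t + 3)))) /\
     exists Phi : (dcoords -> R) -> holo -> C,
       (forall y, divisor_domain y ->
          forall z, identified c y z <-> forall k, z k = Phi y k) /\
       (forall y y', divisor_domain y -> divisor_domain y' ->
          ((forall k, Phi y k = Phi y' k) <-> same_divisor_point y y')) /\
       (forall z : holo -> C, z z_u <> RtoC 0 -> z z_v <> RtoC 0 ->
          exists y, divisor_domain y /\ forall k, Phi y k = z k) /\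
       (forall y, divisor_domain y -> forall a b : dcoords,
          pullback_hermitian Phi (kronheimer_metric c) y a b
          = RtoC (divisor_metric y a b))).
Proof.
split; [split; [|split; [|split]]|split; [|split]].
- exact orthotoric_metric_invariant.
- exact orthotoric_form_invariant.
- exact orthotoric_kahler.
- exact orthotoric_ricci_flat.
- exact divisor_riemannian.
- exact restriction_to_divisor.
- intros c; split; [intros t w; apply moment_relation_iff|].
  exists chart; split; [|split; [|split]].
  + intros y Hy z; now apply identified_chart.
  + exact chart_inj.
  + exact chart_onto.
  + intros y Hy a b; now apply pullback_kronheimer.
Qed.
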